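(* Let $\alpha\in(1,2]$, $\eta\in(0,1]$, $\theta\in(0,\tfrac12)$, $\lambda\in[0,\tfrac{2}{\eta^2})$, and let $f\in C([0,1]\times[0,\infty),[0,\infty))$. Let $$f_{0}=\lim_{x\to 0^{+}}\min_{t\in[0,1]}\frac{f(t,x)}{x},\qquad f^{\infty}=\lim_{x\to+\infty}\max_{t\in[0,1]}\frac{f(t,x)}{x}$$ (limits in $[0,+\infty]$, assumed to exist), and let $$\Lambda_1=\Bigg(\theta^4\int_\theta^{1-\theta}\Big(\mathcal G(s,s)+\frac{\lambda}{2-\lambda\eta^2}\mathcal H(\eta,s)\Big)ds\Bigg)^{-1},\qquad \Lambda_2=\Bigg(\Big(1+\frac{\lambda}{2-\lambda\eta^2}\Big)\int_0^1\mathcal G(s,s)\,ds\Bigg)^{-1}.$$ If $f_0>\Lambda_1$ and $f^\infty<\frac{\Lambda_2}{2}$, then the boundary value problem $$D^\alpha x(t)+f(t,x(t))=0,\quad t\in[0,1],\qquad x(0)=0,\quad x(1)=\lambda\int_0^\eta x(t)\,dt,$$ has at least one positive solution.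
   Context: Conformable derivative: for $\alpha\in(1,2]$ and a function $x$ that is differentiable at points $t>0$, $D^\alpha x(t)=\lim_{\epsilon\to0}\frac{x'(t+\epsilon t^{2-\alpha})-x'(t)}{\epsilon}$ for $t>0$, provided the limit exists (one-sided at the right endpoint of the interval); equivalently $D^\alpha x(t)=t^{2-\alpha}x''(t)$ for $t>0$. At $t=0$, $D^\alpha x(0)=\lim_{t\to0^+}D^\alpha x(t)$, provided this limit exists. A solution of the boundary value problem is a function $x\in C([0,1],\mathbb R)$, differentiable on $(0,1]$, for which $D^\alpha x$ exists on $[0,1]$, and which satisfies the equation and the boundary conditions. A positive solution is a solution $x$ with $x(t)\ge0$ for all $t\in[0,1]$ and $x\not\equiv0$. The functions $\mathcal G,\mathcal H$ are, for $t\in[0,1]$ and $s\in(0,1]$, $$\mathcal G(t,s)=\begin{cases}(1-t)s^{\alpha-1},& s\le t,\\ t(1-s)s^{\alpha-2},& t\le s,\end{cases}\qquad \mathcal H(t,s)=\begin{cases}(2t-t^2-s)s^{\alpha-1},& s\le t,\\ t^2(1-s)s^{\alpha-2},& t\le s.\end{cases}$$ In particular $\mathcal G(s,s)=(1-s)s^{\alpha-1}$. *)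

(* Defs.v *)
From Stdlib Require Import Reals Lra.
From Coquelicot Require Import Coquelicot.
Open Scope R_scope.

(** Functions on [[0,1]] and on [[0,1] x [0,oo)] are represented by total
    functions on [R] and [R * R]; every notion below only looks at their values
    on these domains. *)

Definition unit_interval (t : R) : Prop := 0 <= t <= 1.

Definition strip (p : R * R) : Prop := unit_interval (fst p) /\ 0 <= snd p.

(** Derivative relative to [[0,1]]: two-sided inside, one-sided at the
    endpoints. *)
Definition is_derive_01 (x : R -> R) (t l : R) : Prop :=
  filterlim (fun s => (x s - x t) / (s - t))
    (within (fun s => unit_interval s /\ s <> t) (locally t))
    (locally l).

(** [D^alpha x(t) = l] for [0 < t <= 1]. The increment is restricted so that
    [t + eps t^(2-alpha)] stays in [(0,1]], which is no restriction near
    [eps = 0] when [t < 1] and makes the limit one-sided at [t = 1]. *)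
Definition is_conf_derive (alpha : R) (x : R -> R) (t l : R) : Prop :=
  exists x' : R -> R,
    (forall s, 0 < s <= 1 -> is_derive_01 x s (x' s)) /\
    filterlim
      (fun eps => (x' (t + eps * Rpower t (2 - alpha)) - x' t) / eps)
      (within (fun eps => eps <> 0 /\ 0 < t + eps * Rpower t (2 - alpha) <= 1)
         (locally 0))
      (locally l).

(** [D^alpha x] exists on the whole of [[0,1]] and equals [D] there; the value
    at [0] is the right limit of the values at [t > 0]. *)
Definition is_conf_derive_on_01 (alpha : R) (x D : R -> R) : Prop :=
  (forall t, 0 < t <= 1 -> is_conf_derive alpha x t (D t)) /\
  filterlim D (at_right 0) (locally (D 0)).

(** The kernels are only meant for [0 <= t <= 1] and [0 < s <= 1]. *)
Definition G (alpha t s : R) : R :=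
  if Rle_dec s t then (1 - t) * Rpower s (alpha - 1)
  else t * (1 - s) * Rpower s (alpha - 2).

Definition H (alpha t s : R) : R :=
  if Rle_dec s t then (2 * t - t ^ 2 - s) * Rpower s (alpha - 1)
  else t ^ 2 * (1 - s) * Rpower s (alpha - 2).

Definition Lambda1 (alpha eta theta lambda : R) : R :=
  / (theta ^ 4 *
     RInt (fun s => G alpha s s + lambda / (2 - lambda * eta ^ 2) * H alpha eta s)
       theta (1 - theta)).

(** [Rpower 0 (alpha - 1)] is [1] rather than [0]; the integral does not depend
    on the value of the integrand at the single point [s = 0]. *)
Definition Lambda2 (alpha eta lambda : R) : R :=
  / ((1 + lambda / (2 - lambda * eta ^ 2)) * RInt (fun s => G alpha s s) 0 1).

Definition is_min_01 (g : R -> R) (m : R) : Prop :=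
  (exists t, unit_interval t /\ g t = m) /\
  (forall t, unit_interval t -> m <= g t).

Definition is_max_01 (g : R -> R) (m : R) : Prop :=
  (exists t, unit_interval t /\ g t = m) /\
  (forall t, unit_interval t -> g t <= m).

(** [l = lim_(x -> 0+) min_(t in [0,1]) f(t,x)/x]. *)
Definition is_f_0 (f : R -> R -> R) (l : Rbar) : Prop :=
  exists m : R -> R,
    (forall x, 0 < x -> is_min_01 (fun t => f t x / x) (m x)) /\
    filterlim m (at_right 0) (Rbar_locally l).

(** [l = lim_(x -> +oo) max_(t in [0,1]) f(t,x)/x]. *)
Definition is_f_infty (f : R -> R -> R) (l : Rbar) : Prop :=
  exists M : R -> R,
    (forall x, 0 < x -> is_max_01 (fun t => f t x / x) (M x)) /\
    filterlim M (Rbar_locally p_infty) (Rbar_locally l).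

Definition is_solution (alpha eta lambda : R) (f : R -> R -> R) (x : R -> R)
  : Prop :=
  continuous_on unit_interval x /\
  (forall t, 0 < t <= 1 -> exists l, is_derive_01 x t l) /\
  (exists D : R -> R,
     is_conf_derive_on_01 alpha x D /\
     forall t, unit_interval t -> D t + f t (x t) = 0) /\
  x 0 = 0 /\
  x 1 = lambda * RInt x 0 eta.

Definition is_positive_solution (alpha eta lambda : R) (f : R -> R -> R)
  (x : R -> R) : Prop :=
  is_solution alpha eta lambda f x /\
  (forall t, unit_interval t -> 0 <= x t) /\
  (exists t, unit_interval t /\ x t <> 0).

(* Main.v *)
Require Import Defs.
From Stdlib Require Import Reals Lra Lia Classical IndefiniteDescription.
From Coquelicot Require Import Coquelicot.
From mathcomp Require filter.
Open Scope R_scope.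

(** For [t > 0] the equation reads [x''(t) = - t^(alpha-2) f(t, x(t))]. With
    [x(0) = 0] and [p = x'(0)] it is equivalent to
      [x(t) = p t - int_0^t (t - s) s^(alpha-2) f(s, x(s)) ds],
    and the boundary value problem asks for a slope [p] at which the defect
    [x(1) - lambda int_0^eta x] vanishes. The proof is a shooting argument in [p].

    For a large slope the defect is nonnegative. Since [f >= 0], [x(t) <= p t], and
    [f^oo < k := Lambda2 / 2] gives [f(t,x) <= C + k x]. Inserting both bounds, the
    defect is at least
    [p (1 - lambda eta^2 / 2 - k int_0^1 G(s,s) ds)] up to a constant, and the
    value of [Lambda2] makes the coefficient of [p] positive
    ([defect_large_slope], [Lambda2_bounds]).

    For a small slope the defect is nonpositive. The graph stays in the region where
    [f(t,x) >= Lambda1 x]. If the defect were positive, [x] would be concave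
    and nonnegative, and Green's representation would give
      [x(1/2) >= 1/2 int_0^1 (G(s,s) + mu H(eta,s)) f(s,x(s)) ds]
    with [mu = lambda / (2 - lambda eta^2)]. A Harnack inequality bounds [x] on
    [[theta, 1 - theta]] below by a multiple of [x(1/2)], so this reads
    [x(1/2) >= c x(1/2)], where [c > 1] by the definition of [Lambda1]; hence
    [x(1/2) <= 0], and by Harnack again [x <= 0], against [p > 0]
    ([defect_small_slope]).

    As [f] is only continuous, a slope does not determine [x], so the
    intermediate value theorem does not apply to the defect directly. Replacing
    [f(s, x(s))] by [f(s, x(s - h))] makes the initial value problem solvable
    by finitely many explicit steps, continuously in [p]
    ([delayed_solves], [delayed_continuous_in_slope]). Both sign estimates
    hold for the delayed problem, so for every small [h] some slope between the two
    has defect zero ([delayed_shooting]). These delayed solutions are uniformly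
    Lipschitz, and a cluster point as [h] tends to 0 solves the original problem
    ([ascoli_cluster], [shooting]). Its slope is still positive, so
    it is not the zero function.

    The singular weight [s^(alpha-2)] is removed throughout by the substitution
    [s = u^q], [q = 1 / (alpha - 1)], which turns [s^(alpha-2) ds] into [q du]. *)

(** * Continuous functions, clipping and the power substitution *)

Definition cont (f : R -> R) : Prop := forall x, continuous f x.

Lemma cont_const c : cont (fun _ => c).
Proof. intro x; apply continuous_const. Qed.

Lemma cont_id : cont (fun x => x).
Proof. intro x; apply continuous_id. Qed.

Lemma cont_plus f g : cont f -> cont g -> cont (fun x => f x + g x).
Proof. intros Hf Hg x; apply (continuous_plus (V := R_NormedModule)); auto. Qed.

Lemma cont_minus f g : cont f -> cont g -> cont (fun x => f x - g x).
Proof. intros Hf Hg x; apply (continuous_minus (V := R_NormedModule)); auto. Qed.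

Lemma cont_mult f g : cont f -> cont g -> cont (fun x => f x * g x).
Proof. intros Hf Hg x; apply (continuous_mult (K := R_AbsRing)); auto. Qed.

Lemma cont_comp f g : cont f -> cont g -> cont (fun x => f (g x)).
Proof. intros Hf Hg x; apply continuous_comp; auto. Qed.

Lemma cont_Rabs f : cont f -> cont (fun x => Rabs (f x)).
Proof. intros Hf x; apply continuous_Rabs_comp; auto. Qed.

Lemma cont_ext f g : (forall x, f x = g x) -> cont f -> cont g.
Proof. intros Hfg Hf x; apply (continuous_ext f); auto. Qed.

Lemma cont_Rmax f g : cont f -> cont g -> cont (fun x => Rmax (f x) (g x)).
Proof.
  intros Hf Hg.
  apply (cont_ext (fun x => (f x + g x + Rabs (f x - g x)) * / 2)).
  { intro x; unfold Rmax; destruct (Rle_dec (f x) (g x));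
      unfold Rabs; destruct (Rcase_abs (f x - g x)); lra. }
  apply cont_mult; [|apply cont_const].
  apply cont_plus; [now apply cont_plus|now apply cont_Rabs, cont_minus].
Qed.

Lemma cont_lipschitz f L :
  (forall s t, Rabs (f s - f t) <= L * Rabs (s - t)) -> cont f.
Proof.
  intros HL x P [e He].
  assert (HL' : 0 < Rmax 1 L) by (generalize (Rmax_l 1 L); lra).
  assert (Hd : 0 < e / Rmax 1 L) by (apply Rdiv_lt_0_compat; [apply e|lra]).
  exists (mkposreal _ Hd); intros y Hy; apply He.
  change (Rabs (f y - f x) < e); change (Rabs (y - x) < e / Rmax 1 L) in Hy.
  apply Rle_lt_trans with (Rmax 1 L * Rabs (y - x)).
  - eapply Rle_trans; [apply HL|].
    apply Rmult_le_compat_r; [apply Rabs_pos|apply Rmax_r].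
  - apply (Rmult_lt_compat_l (Rmax 1 L)) in Hy; [|lra].
    replace (Rmax 1 L * (e / Rmax 1 L)) with (pos e) in Hy by (field; lra); lra.
Qed.

Ltac cont :=
  match goal with
  | H : cont ?f |- cont ?f => exact H
  | |- cont (fun _ => ?c) => apply cont_const
  | |- cont (fun x => x) => apply cont_id
  | |- cont (fun x => @?f x - @?g x) => apply (cont_minus f g); cont
  | |- cont (fun x => @?f x + @?g x) => apply (cont_plus f g); cont
  | |- cont (fun x => @?f x * @?g x) => apply (cont_mult f g); cont
  | |- cont (fun x => Rmax (@?f x) (@?g x)) => apply (cont_Rmax f g); cont
  end.

Lemma cont_ex_RInt f a b : cont f -> ex_RInt f a b.
Proof. intros Hf; apply (ex_RInt_continuous (V := R_CompleteNormedModule)); auto. Qed.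

Lemma RInt_close f g a b e :
  a <= b -> ex_RInt f a b -> ex_RInt g a b ->
  (forall u, a <= u <= b -> Rabs (f u - g u) <= e) ->
  Rabs (RInt f a b - RInt g a b) <= (b - a) * e.
Proof.
  intros Hab Hf Hg Hfg.
  apply (norm_RInt_le_const (V := R_NormedModule) (fun u => f u - g u) a b); auto.
  apply (is_RInt_minus (V := R_NormedModule));
    now apply (RInt_correct (V := R_CompleteNormedModule)).
Qed.

(** Clipping makes functions given on an interval total, with unchanged
    bounds and Lipschitz constants. *)
Definition clip (a b t : R) : R := Rmax a (Rmin b t).

Lemma clip_range a b t : a <= b -> a <= clip a b t <= b.
Proof.
  intros Hab; unfold clip, Rmax, Rmin.
  destruct (Rle_dec b t); destruct (Rle_dec a _); lra.
Qed.

Lemma clip_id a b t : a <= t <= b -> clip a b t = t.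
Proof.
  intros Ht; unfold clip, Rmax, Rmin.
  destruct (Rle_dec b t); destruct (Rle_dec a _); lra.
Qed.

Lemma clip_lipschitz a b s t : Rabs (clip a b s - clip a b t) <= Rabs (s - t).
Proof.
  unfold clip, Rmax, Rmin.
  destruct (Rle_dec b s); destruct (Rle_dec b t);
  repeat match goal with |- context [Rle_dec ?x ?z] => destruct (Rle_dec x z) end;
  unfold Rabs; repeat destruct Rcase_abs; lra.
Qed.

(** The power [u^q] extended by 0 to [u <= 0]: with [Rpower] alone, the
    substitution [s = u^q] would break down at [u = 0]. *)
Definition powr0 (q u : R) : R := if Rle_dec u 0 then 0 else Rpower u q.

Lemma powr0_pos_eq q u : 0 < u -> powr0 q u = Rpower u q.
Proof. intros Hu; unfold powr0; destruct (Rle_dec u 0); lra. Qed.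

Lemma powr0_ge_0 q u : 0 <= powr0 q u.
Proof.
  unfold powr0; destruct (Rle_dec u 0); [lra|].
  left; apply exp_pos.
Qed.

Lemma Rpower_1_base q : Rpower 1 q = 1.
Proof. unfold Rpower; rewrite ln_1, Rmult_0_r; apply exp_0. Qed.

Lemma powr0_mono q u v : 0 <= q -> u <= v -> powr0 q u <= powr0 q v.
Proof.
  intros Hq Huv; destruct (Rle_dec u 0) as [Hu|Hu].
  - unfold powr0 at 1; destruct (Rle_dec u 0); [apply powr0_ge_0|lra].
  - rewrite !powr0_pos_eq by lra; apply Rle_Rpower_l; lra.
Qed.

Lemma powr0_range q u : 0 <= q -> 0 <= u <= 1 -> 0 <= powr0 q u <= 1.
Proof.
  intros Hq Hu; split; [apply powr0_ge_0|].
  replace 1 with (powr0 q 1) by (rewrite powr0_pos_eq by lra; apply Rpower_1_base).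
  apply powr0_mono; lra.
Qed.

Lemma powr0_lt_iff q u t :
  0 < q -> 0 < u -> 0 < t -> powr0 q u < t <-> u < Rpower t (/ q).
Proof.
  intros Hq Hu Ht; rewrite powr0_pos_eq by assumption.
  assert (Hi : 0 < / q) by now apply Rinv_0_lt_compat.
  assert (E1 : Rpower (Rpower u q) (/ q) = u)
    by (rewrite Rpower_mult, Rinv_r, Rpower_1; lra).
  assert (E2 : Rpower (Rpower t (/ q)) q = t)
    by (rewrite Rpower_mult, Rinv_l, Rpower_1; lra).
  split; intro Hlt.
  - rewrite <- E1; apply Rlt_Rpower_l; [assumption|]; split; [apply exp_pos|exact Hlt].
  - rewrite <- E2; apply Rlt_Rpower_l; [assumption|]; split; assumption.
Qed.

Lemma cont_powr0 q : 0 < q -> cont (powr0 q).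
Proof.
  intros Hq x; destruct (Rtotal_order x 0) as [Hx|[Hx|Hx]].
  - apply (continuous_ext_loc _ (fun _ => 0)); [|apply continuous_const].
    assert (Hd : 0 < - x) by lra.
    exists (mkposreal _ Hd); intros u Hu.
    apply Rabs_lt_between' in Hu; simpl in Hu.
    unfold powr0; destruct (Rle_dec u 0); lra.
  - subst x; intros P [e He].
    assert (Hd : 0 < Rpower e (/ q)) by apply exp_pos.
    exists (mkposreal _ Hd); intros u Hu; apply He.
    change (Rabs (u - 0) < Rpower e (/ q)) in Hu.
    change (Rabs (powr0 q u - powr0 q 0) < e).
    assert (Hnp : forall v, v <= 0 -> powr0 q v = 0)
      by (intros v Hv; unfold powr0; destruct (Rle_dec v 0); lra).
    rewrite (Hnp 0), Rminus_0_r, Rabs_right by (apply Rle_ge, powr0_ge_0 || lra).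
    destruct (Rle_dec u 0) as [H0|H0]; [rewrite Hnp by exact H0; apply cond_pos|].
    apply powr0_lt_iff; [lra|lra|apply cond_pos|].
    rewrite Rminus_0_r, Rabs_right in Hu; lra.
  - apply (continuous_ext_loc _ (fun u => Rpower u q)).
    + exists (mkposreal _ Hx); intros u Hu.
      apply Rabs_lt_between' in Hu; simpl in Hu.
      symmetry; apply powr0_pos_eq; lra.
    + apply (ex_derive_continuous (K := R_AbsRing) (V := R_NormedModule)).
      exists (q * Rpower x (q - 1)); apply is_derive_Reals.
      now apply derivable_pt_lim_power.
Qed.

Lemma powr0_Rpower_inv q t : 0 < q -> 0 < t -> powr0 q (Rpower t (/ q)) = t.
Proof.
  intros Hq Ht; rewrite powr0_pos_eq by apply exp_pos.
  rewrite Rpower_mult, Rinv_l, Rpower_1; lra.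
Qed.

(** * Weighted integrals *)

(** After [s = powr0 q u] with [q = 1 / (alpha - 1)], this is the integral of
    [phi(s) s^(alpha-2)] over [[0,1]] against the density that [y] gives as a
    function of [u] rather than of [s]. *)
Definition moment (q : R) (y phi : R -> R) : R :=
  q * RInt (fun u => phi (powr0 q u) * y u) 0 1.

Section Functional.
Context (q : R) (y : R -> R) (Hq : 1 <= q) (Hy : cont y).

Lemma moment_integrable phi a b : cont phi -> ex_RInt (fun u => phi (powr0 q u) * y u) a b.
Proof using Hq Hy.
  intros Hphi; apply cont_ex_RInt, cont_mult; [|exact Hy].
  apply cont_comp; [exact Hphi|apply cont_powr0; lra].
Qed.

Lemma moment_ext phi psi :
  (forall s, 0 <= s <= 1 -> phi s = psi s) -> moment q y phi = moment q y psi.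
Proof using Hq.
  intros Heq; unfold moment; f_equal; apply RInt_ext; intros u Hu.
  rewrite Rmin_left, Rmax_right in Hu by lra.
  rewrite Heq; [reflexivity|apply powr0_range; lra].
Qed.

Lemma moment_plus phi psi :
  cont phi -> cont psi -> moment q y (fun s => phi s + psi s) = moment q y phi + moment q y psi.
Proof using Hq Hy.
  intros Hphi Hpsi; unfold moment; rewrite <- Rmult_plus_distr_l; f_equal.
  rewrite <- (RInt_plus (V := R_CompleteNormedModule)) by now apply moment_integrable.
  apply RInt_ext; intros u _; unfold plus; simpl; ring.
Qed.

Lemma moment_scal c phi : cont phi -> moment q y (fun s => c * phi s) = c * moment q y phi.
Proof using Hq Hy.
  intros Hphi; unfold moment.
  transitivity (q * (c * RInt (fun u => phi (powr0 q u) * y u) 0 1)); [|ring].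
  f_equal; rewrite <- (RInt_scal (V := R_CompleteNormedModule)) by now apply moment_integrable.
  apply RInt_ext; intros u _; unfold scal; simpl; unfold mult; simpl; ring.
Qed.

Lemma moment_minus phi psi :
  cont phi -> cont psi -> moment q y (fun s => phi s - psi s) = moment q y phi - moment q y psi.
Proof using Hq Hy.
  intros Hphi Hpsi.
  replace (moment q y phi - moment q y psi) with (moment q y phi + (-1) * moment q y psi) by ring.
  rewrite <- moment_scal, <- moment_plus by cont; apply moment_ext; intros; ring.
Qed.

Lemma moment_le phi psi :
  cont phi -> cont psi -> (forall u, 0 <= u <= 1 -> 0 <= y u) ->
  (forall s, 0 <= s <= 1 -> phi s <= psi s) -> moment q y phi <= moment q y psi.
Proof using Hq Hy.
  intros Hphi Hpsi Hpos Hle; unfold moment; apply Rmult_le_compat_l; [lra|].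
  apply RInt_le; [lra|now apply moment_integrable|now apply moment_integrable|].
  intros u Hu; apply Rmult_le_compat_r; [apply Hpos; lra|].
  apply Hle, powr0_range; lra.
Qed.

Lemma moment_ge_0 phi :
  cont phi -> (forall u, 0 <= u <= 1 -> 0 <= y u) ->
  (forall s, 0 <= s <= 1 -> 0 <= phi s) -> 0 <= moment q y phi.
Proof using Hq Hy.
  intros Hphi Hpos Hle; unfold moment; apply Rmult_le_pos; [lra|].
  apply RInt_ge_0; [lra|now apply moment_integrable|].
  intros u Hu; apply Rmult_le_pos; [|apply Hpos; lra].
  apply Hle, powr0_range; lra.
Qed.

End Functional.

Lemma moment_close q y z phi psi e :
  1 <= q -> cont y -> cont z -> cont phi -> cont psi ->
  (forall u, 0 <= u <= 1 ->
     Rabs (phi (powr0 q u) * y u - psi (powr0 q u) * z u) <= e) ->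
  Rabs (moment q y phi - moment q z psi) <= q * e.
Proof.
  intros Hq Hy Hz Hphi Hpsi He; unfold moment.
  rewrite <- Rmult_minus_distr_l, Rabs_mult, (Rabs_right q) by lra.
  apply Rmult_le_compat_l; [lra|].
  replace e with ((1 - 0) * e) by ring.
  apply RInt_close; auto; [lra| |]; now apply moment_integrable.
Qed.

(** * Green kernels and concave paths *)

(** The function with [path(0) = 0], initial slope [p] and second
    derivative [- s^(alpha-2) y]; the positive part cuts the integral off at [t]. *)
Definition path (q p : R) (y : R -> R) (t : R) : R :=
  p * t - moment q y (fun s => Rmax 0 (t - s)).

(** [s^(alpha-2) green t s] is the kernel [G(t,s)] of the problem with zero
    boundary values. *)
Definition green (t s : R) : R := t * (1 - s) - Rmax 0 (t - s).

(** Twice the integral of [green t s] over [t] in [[0,eta]];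
    [s^(alpha-2) green_mean eta s] is the kernel [H(eta,s)]. *)
Definition green_mean (eta s : R) : R := eta ^ 2 * (1 - s) - Rmax 0 (eta - s) ^ 2.

Lemma cont_ramp t : cont (fun s => Rmax 0 (t - s)).
Proof. cont. Qed.

Lemma cont_green t : cont (green t).
Proof. unfold green; cont. Qed.

Lemma cont_green_mean eta : cont (green_mean eta).
Proof.
  apply (cont_ext (fun s => eta * eta * (1 - s) - Rmax 0 (eta - s) * Rmax 0 (eta - s))).
  { intro s; unfold green_mean; ring. }
  cont.
Qed.

Lemma ramp_cases t s :
  (s <= t /\ Rmax 0 (t - s) = t - s) \/ (t <= s /\ Rmax 0 (t - s) = 0).
Proof. unfold Rmax; destruct (Rle_dec 0 (t - s)); lra. Qed.

Lemma ramp_lipschitz s t r : Rabs (Rmax 0 (s - r) - Rmax 0 (t - r)) <= Rabs (s - t).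
Proof.
  destruct (ramp_cases s r) as [[? ->]|[? ->]], (ramp_cases t r) as [[? ->]|[? ->]];
  unfold Rabs; repeat destruct Rcase_abs; lra.
Qed.

Lemma ramp_square_taylor s t r :
  Rabs (Rmax 0 (s - r) * Rmax 0 (s - r)
        - (Rmax 0 (t - r) * Rmax 0 (t - r) + 2 * (s - t) * Rmax 0 (t - r)))
  <= (s - t) ^ 2.
Proof.
  apply Rabs_le_between.
  assert (H1 := pow2_ge_0 (s - t)); assert (H2 := pow2_ge_0 (s - r)).
  destruct (ramp_cases s r) as [[? ->]|[? ->]], (ramp_cases t r) as [[? ->]|[? ->]];
    split; nra.
Qed.

Lemma green_ge_0 t s : 0 <= t <= 1 -> 0 <= s <= 1 -> 0 <= green t s.
Proof.
  intros Ht Hs; unfold green; destruct (ramp_cases t s) as [[? ->]|[? ->]]; nra.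
Qed.

(** As [green t s = min(s,t) (1 - max(s,t))], the ratio of two such kernels is at
    least the smaller of [t / tau] and [(1 - t) / (1 - tau)]. *)
Lemma green_harnack t tau s :
  0 <= t <= 1 -> 0 <= tau <= 1 -> 0 <= s <= 1 ->
  Rmin t (1 - t) * green tau s <= green t s.
Proof.
  intros Ht Htau Hs.
  assert (Ha : 0 <= Rmin t (1 - t)) by (apply Rmin_glb; lra).
  assert (Ha1 := Rmin_l t (1 - t)); assert (Ha2 := Rmin_r t (1 - t)).
  set (a := Rmin t (1 - t)) in *.
  assert (Hg : green tau s <= s /\ green tau s <= 1 - s /\ 0 <= green tau s).
  { split; [|split; [|now apply green_ge_0]];
    unfold green; destruct (ramp_cases tau s) as [[? ->]|[? ->]]; nra. }
  destruct (ramp_cases t s) as [[? E]|[? E]]; unfold green at 2; rewrite E; nra.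
Qed.

Lemma green_half s : 0 <= s <= 1 -> s * (1 - s) / 2 <= green (1 / 2) s.
Proof.
  intros Hs; unfold green; destruct (ramp_cases (1 / 2) s) as [[? ->]|[? ->]]; nra.
Qed.

Lemma green_mean_ge_0 eta s : 0 <= eta <= 1 -> 0 <= s <= 1 -> 0 <= green_mean eta s.
Proof.
  intros He Hs; unfold green_mean; destruct (ramp_cases eta s) as [[? ->]|[? ->]].
  - replace (eta ^ 2 * (1 - s) - (eta - s) ^ 2)
      with (s * ((eta - s) + eta * (1 - eta))) by ring.
    apply Rmult_le_pos; nra.
  - nra.
Qed.

(** Serves to differentiate under the integral sign when the integrand is
    only once differentiable, with a Lipschitz derivative. *)
Lemma is_derive_quadratic f t l C :
  (forall s, Rabs (f s - f t - (s - t) * l) <= C * (s - t) ^ 2) -> is_derive f t l.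
Proof.
  intros HC; apply is_derive_Reals; intros e He.
  assert (HC' : 0 < Rmax 1 C) by (generalize (Rmax_l 1 C); lra).
  assert (Hd : 0 < e / Rmax 1 C) by (apply Rdiv_lt_0_compat; lra).
  exists (mkposreal _ Hd); intros h Hh0 Hh; simpl in Hh.
  specialize (HC (t + h)); replace (t + h - t) with h in HC by ring.
  replace ((f (t + h) - f t) / h - l) with ((f (t + h) - f t - h * l) / h)
    by (now field).
  rewrite Rabs_div by assumption.
  assert (Hp : 0 < Rabs h) by now apply Rabs_pos_lt.
  apply Rlt_div_l; [assumption|].
  apply Rle_lt_trans with (Rmax 1 C * Rabs h * Rabs h).
  - eapply Rle_trans; [exact HC|].
    rewrite <- (pow2_abs h); simpl; rewrite Rmult_1_r, Rmult_assoc.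
    apply Rmult_le_compat_r; [nra|apply Rmax_r].
  - apply Rmult_lt_compat_r; [assumption|].
    rewrite Rmult_comm; now apply Rlt_div_r in Hh.
Qed.

Lemma path_at_0 q p y : 1 <= q -> cont y -> path q p y 0 = 0.
Proof.
  intros Hq Hy; unfold path.
  rewrite (moment_ext q y Hq _ (fun s => 0 * 0)).
  - rewrite (moment_scal q y Hq Hy 0 (fun _ => 0)) by cont; ring.
  - intros s Hs; destruct (ramp_cases 0 s) as [[? ->]|[? ->]]; lra.
Qed.

Section Path.
Context (q p M : R) (y : R -> R) (Hq : 1 <= q) (Hy : cont y).
Context (Hpos : forall u, 0 <= u <= 1 -> 0 <= y u <= M).

Let Hy0 : forall u, 0 <= u <= 1 -> 0 <= y u.
Proof. intros u Hu; now apply Hpos. Qed.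

Lemma path_le t : path q p y t <= p * t.
Proof using Hq Hy Hpos.
  unfold path.
  assert (0 <= moment q y (fun s => Rmax 0 (t - s))); [|lra].
  apply moment_ge_0; auto; [apply cont_ramp|intros; apply Rmax_l].
Qed.

Lemma path_lipschitz s t :
  Rabs (path q p y s - path q p y t) <= (Rabs p + q * M) * Rabs (s - t).
Proof using Hq Hy Hpos.
  assert (HJ : Rabs (moment q y (fun r => Rmax 0 (s - r)) - moment q y (fun r => Rmax 0 (t - r)))
    <= q * (Rabs (s - t) * M)).
  { apply moment_close; auto using cont_ramp; intros u Hu.
    rewrite <- Rmult_minus_distr_r, Rabs_mult.
    apply Rmult_le_compat; try apply Rabs_pos; [apply ramp_lipschitz|].
    specialize (Hpos u Hu); rewrite Rabs_right; lra. }
  unfold path.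
  replace (p * s - moment q y (fun r => Rmax 0 (s - r)) - (p * t - moment q y (fun r => Rmax 0 (t - r))))
    with (p * (s - t) - (moment q y (fun r => Rmax 0 (s - r)) - moment q y (fun r => Rmax 0 (t - r))))
    by ring.
  eapply Rle_trans; [apply Rabs_triang|]; rewrite Rabs_Ropp, Rabs_mult; lra.
Qed.

Lemma cont_path : cont (path q p y).
Proof using Hq Hy Hpos. exact (cont_lipschitz _ _ path_lipschitz). Qed.

(** The difference between [path] and its chord on [[0,1]] is the Green potential
    of the second derivative. *)
Lemma path_chord t : path q p y t = t * path q p y 1 + moment q y (green t).
Proof using Hq Hy.
  unfold green, path; rewrite moment_minus by first [assumption|cont].
  rewrite (moment_scal q y Hq Hy t (fun s => 1 - s)) by cont.
  rewrite (moment_ext q y Hq (fun s => Rmax 0 (1 - s)) (fun s => 1 - s)); [ring|].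
  intros s Hs; destruct (ramp_cases 1 s) as [[? ->]|[? ->]]; lra.
Qed.

Lemma moment_green_harnack t tau :
  0 <= t <= 1 -> 0 <= tau <= 1 ->
  Rmin t (1 - t) * moment q y (green tau) <= moment q y (green t).
Proof using Hq Hy Hpos.
  intros Ht Htau; rewrite <- moment_scal by auto using cont_green.
  apply moment_le; auto; [|apply cont_green|intros; now apply green_harnack].
  apply (cont_mult (fun _ => Rmin t (1 - t))); [apply cont_const|apply cont_green].
Qed.

(** The Harnack inequality for concave functions that vanish at 0 and are
    nonnegative at 1: the kernels satisfy it, and so does the chord. *)
Lemma path_harnack t tau :
  0 <= path q p y 1 -> 0 <= t <= 1 -> 0 <= tau <= 1 ->
  Rmin t (1 - t) * path q p y tau <= path q p y t.
Proof using Hq Hy Hpos.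
  intros H1 Ht Htau; rewrite (path_chord t), (path_chord tau).
  assert (HJ := moment_green_harnack t tau Ht Htau).
  assert (Rmin t (1 - t) <= t) by apply Rmin_l.
  assert (0 <= Rmin t (1 - t)) by (apply Rmin_glb; lra).
  assert (Rmin t (1 - t) * tau <= t) by nra.
  nra.
Qed.

Lemma path_ge_0 t : 0 <= path q p y 1 -> 0 <= t <= 1 -> 0 <= path q p y t.
Proof using Hq Hy Hpos.
  intros H1 Ht; rewrite path_chord.
  assert (0 <= moment q y (green t)).
  { apply moment_ge_0; auto; [apply cont_green|intros; now apply green_ge_0]. }
  nra.
Qed.

(** Taylor's formula for the square of the positive part makes the
    error quadratic, uniformly in the integration variable. *)
Lemma is_derive_path_primitive t :
  is_derive (fun t => p * t ^ 2 / 2 - / 2 * moment q y (fun s => Rmax 0 (t - s) * Rmax 0 (t - s)))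
    t (path q p y t).
Proof using Hq Hy Hpos.
  apply (is_derive_quadratic _ _ _ (Rabs p + q * M)); intros s.
  set (A := fun t => moment q y (fun s => Rmax 0 (t - s) * Rmax 0 (t - s))).
  assert (HJ : Rabs (moment q y (fun r => Rmax 0 (s - r) * Rmax 0 (s - r)) - moment q y (fun r => Rmax 0 (t - r) * Rmax 0 (t - r)
      + 2 * (s - t) * Rmax 0 (t - r))) <= q * ((s - t) ^ 2 * M)).
  { apply moment_close; try assumption.
    { cont. }
    { cont. }
    intros u Hu.
    rewrite <- Rmult_minus_distr_r, Rabs_mult.
    apply Rmult_le_compat; try apply Rabs_pos;
      [|specialize (Hpos u Hu); rewrite Rabs_right; lra].
    apply ramp_square_taylor. }
  rewrite moment_plus in HJ by first [assumption|cont].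
  rewrite (moment_scal q y Hq Hy (2 * (s - t))) in HJ by cont.
  fold (A t) in HJ; fold (A s) in HJ; fold (A s) (A t).
  set (K := moment q y (fun r => Rmax 0 (t - r))) in *.
  unfold path; fold K.
  assert (HM : 0 <= q * M) by (specialize (Hpos 0 ltac:(lra)); nra).
  replace (p * s ^ 2 / 2 - / 2 * A s - (p * t ^ 2 / 2 - / 2 * A t) - (s - t) * (p * t - K))
    with (/ 2 * (p * (s - t) ^ 2) + - (/ 2 * (A s - (A t + 2 * (s - t) * K)))) by field.
  eapply Rle_trans; [apply Rabs_triang|].
  rewrite Rabs_Ropp, !Rabs_mult, (Rabs_right (/ 2)) by lra.
  rewrite (Rabs_right ((s - t) ^ 2)) by (apply Rle_ge, pow2_ge_0).
  assert (H1 := Rabs_pos p); assert (H2 := pow2_ge_0 (s - t)); nra.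
Qed.

Lemma RInt_path eta :
  RInt (path q p y) 0 eta
  = p * eta ^ 2 / 2 - / 2 * moment q y (fun s => Rmax 0 (eta - s) * Rmax 0 (eta - s)).
Proof using Hq Hy Hpos.
  set (F := fun t => p * t ^ 2 / 2
    - / 2 * moment q y (fun s => Rmax 0 (t - s) * Rmax 0 (t - s))).
  assert (HF0 : F 0 = 0).
  { unfold F; rewrite (moment_ext q y Hq _ (fun s => 0 * 0)).
    - rewrite (moment_scal q y Hq Hy 0 (fun _ => 0)) by cont; field.
    - intros s Hs; destruct (ramp_cases 0 s) as [[? ->]|[? ->]]; nra. }
  fold (F eta); replace (F eta) with (minus (F eta) (F 0))
    by (rewrite HF0; unfold minus, plus, opp; simpl; ring).
  apply is_RInt_unique, (is_RInt_derive (V := R_CompleteNormedModule)); intros t _;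
    [apply is_derive_path_primitive|apply cont_path].
Qed.

(** Once [p] is eliminated by [p = path(1) + moment (1 - s)], the integral
    condition becomes linear in [path(1)], with coefficient
    [1 - lambda eta^2 / 2 > 0]. *)
Lemma path_end_lower lambda eta :
  0 <= lambda -> lambda * eta ^ 2 < 2 ->
  lambda * RInt (path q p y) 0 eta <= path q p y 1 ->
  lambda / (2 - lambda * eta ^ 2) * moment q y (green_mean eta) <= path q p y 1.
Proof using Hq Hy Hpos.
  intros Hl Hle Hbc; rewrite RInt_path in Hbc.
  rewrite (moment_ext q y Hq (green_mean eta)
    (fun s => eta ^ 2 * (1 - s) - Rmax 0 (eta - s) * Rmax 0 (eta - s)))
    by (intros; unfold green_mean; ring).
  rewrite moment_minus by first [assumption|cont].
  rewrite (moment_scal q y Hq Hy (eta ^ 2) (fun s => 1 - s)) by cont.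
  assert (Hp : p = path q p y 1 + moment q y (fun s => 1 - s)).
  { unfold path; rewrite (moment_ext q y Hq (fun s => Rmax 0 (1 - s)) (fun s => 1 - s)); [ring|].
    intros s Hs; destruct (ramp_cases 1 s) as [[? ->]|[? ->]]; lra. }
  set (B := moment q y (fun s => Rmax 0 (eta - s) * Rmax 0 (eta - s))) in *.
  set (A := moment q y (fun s => 1 - s)) in *; set (X := path q p y 1) in *.
  replace (lambda / (2 - lambda * eta ^ 2) * (eta ^ 2 * A - B))
    with (lambda * (eta ^ 2 * A - B) / (2 - lambda * eta ^ 2)) by (field; lra).
  apply Rle_div_l; [lra|].
  rewrite Hp in Hbc; lra.
Qed.

(** The second derivative is integrable at 0, so the linear term [p t] dominates
    for small [t]. *)
Lemma path_positive_somewhere :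
  0 < p -> exists t, 0 < t <= 1 /\ 0 < path q p y t.
Proof using Hq Hy Hpos.
  intros Hp.
  assert (HM : 0 <= M) by (specialize (Hpos 0 ltac:(lra)); lra).
  (* For [t = powr0 q v] only [u <= v] contributes, so the integral is at most
     [q M v t <= p t / 2]. *)
  set (v := Rmin 1 (p / (2 * (q * M + 1)))).
  assert (Hd : 0 < p / (2 * (q * M + 1))) by (apply Rdiv_lt_0_compat; nra).
  assert (Hv0 : 0 < v) by (apply Rmin_pos; lra).
  assert (Hv1 : v <= 1) by apply Rmin_l.
  assert (Hv : v * (q * M + 1) <= p / 2).
  { apply Rle_trans with (p / (2 * (q * M + 1)) * (q * M + 1));
      [apply Rmult_le_compat_r; [nra|apply Rmin_r]|right; field; nra]. }
  exists (powr0 q v); set (t := powr0 q v).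
  assert (Ht0 : 0 < t) by (unfold t; rewrite powr0_pos_eq by assumption; apply exp_pos).
  assert (Ht1 : t <= 1) by (apply powr0_range; lra).
  split; [lra|]; unfold path.
  assert (Hint := fun a b => moment_integrable q y Hq Hy _ a b (cont_ramp t)).
  assert (HJ : RInt (fun u => Rmax 0 (t - powr0 q u) * y u) 0 1 <= v * (t * M)).
  { rewrite <- (RInt_Chasles (V := R_CompleteNormedModule) _ 0 v 1 (Hint _ _) (Hint _ _)).
    unfold plus; simpl.
    assert (E : RInt (fun u => Rmax 0 (t - powr0 q u) * y u) v 1 = 0).
    { rewrite (RInt_ext _ (fun _ => 0)).
      - rewrite RInt_const; unfold scal; simpl; unfold mult; simpl; ring.
      - intros u Hu; rewrite Rmin_left, Rmax_right in Hu by lra.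
        assert (t <= powr0 q u) by (apply powr0_mono; lra).
        destruct (ramp_cases t (powr0 q u)) as [[? ->]|[? ->]]; [|apply Rmult_0_l].
        replace (t - powr0 q u) with 0 by lra; apply Rmult_0_l. }
    rewrite E, Rplus_0_r.
    replace (v * (t * M)) with (RInt (fun _ => t * M) 0 v)
      by (rewrite RInt_const; unfold scal; simpl; unfold mult; simpl; ring).
    apply RInt_le; [lra|apply Hint|apply ex_RInt_const|].
    intros u Hu; specialize (Hpos u ltac:(lra)).
    assert (0 <= powr0 q u) by apply powr0_ge_0.
    apply Rmult_le_compat; try lra; [apply Rmax_l|].
    destruct (ramp_cases t (powr0 q u)) as [[? ->]|[? ->]]; lra. }
  unfold moment.
  assert (q * RInt (fun u => Rmax 0 (t - powr0 q u) * y u) 0 1 <= q * (v * (t * M)))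
    by (apply Rmult_le_compat_l; lra).
  assert (q * (v * (t * M)) <= t * (p / 2)); [|nra].
  replace (q * (v * (t * M))) with (t * (v * (q * M))) by ring.
  apply Rmult_le_compat_l; nra.
Qed.

End Path.

(** * Compactness of Lipschitz functions *)

(** Limits along a free ultrafilter exist for every bounded sequence, so that a
    limit function can be taken pointwise, without diagonal extraction. *)
Record free_ultrafilter (F : (nat -> Prop) -> Prop) : Prop := {
  fu_tail : forall N, F (fun n => (N <= n)%nat);
  fu_and : forall P Q, F P -> F Q -> F (fun n => P n /\ Q n);
  fu_imp : forall P Q : nat -> Prop, (forall n, P n -> Q n) -> F P -> F Q;
  fu_ex : forall P, F P -> exists n, P n;
  fu_dec : forall P, F P \/ F (fun n => ~ P n) }.

Lemma free_ultrafilter_exists : exists F, free_ultrafilter F.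
Proof.
  assert (HE : filter.ProperFilter
    (fun P : nat -> Prop => exists N, forall n, (N <= n)%nat -> P n)).
  { constructor.
    - intros [N HN]; exact (HN N (le_n N)).
    - constructor.
      + exists 0%nat; intros n _; exact I.
      + intros P Q [N HN] [N' HN']; exists (N + N')%nat; intros n Hn.
        split; [apply HN|apply HN']; lia.
      + intros P Q HPQ [N HN]; exists N; intros n Hn; apply HPQ, HN, Hn. }
  destruct (filter.ultraFilterLemma HE) as [F [HF HEF]].
  assert (HP := @filter.ultra_proper _ _ HF).
  destruct HP as [Hne [HT HI HS]].
  exists F; constructor.
  - intro N; apply HEF; exists N; auto.
  - intros P Q; apply HI.
  - intros P Q HPQ; apply HS; exact HPQ.
  - intros P HFP; apply NNPP; intro Hno; apply Hne.
    apply (HS P); [|exact HFP]; intros n Hn; apply Hno; now exists n.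
  - intro P; exact (filter.in_ultra_setVsetC P HF).
Qed.

Section Ultralimit.
Context (F : (nat -> Prop) -> Prop) (HF : free_ultrafilter F).

Lemma fu_not_both P : F P -> F (fun n => ~ P n) -> False.
Proof using HF.
  intros H1 H2; destruct (fu_ex F HF _ (fu_and F HF _ _ H1 H2)) as [n [? ?]]; auto.
Qed.

(** The limit is the supremum of the numbers that are eventually below [u]. *)
Lemma ultralimit (B : R) (u : nat -> R) :
  (forall n, Rabs (u n) <= B) ->
  exists l, forall e, 0 < e -> F (fun n => Rabs (u n - l) < e).
Proof using HF.
  intros HB.
  assert (HB' : forall n, - B <= u n <= B) by (intro; now apply Rabs_le_between).
  destruct (completeness (fun a => F (fun n => a <= u n))) as [l [Hub Hlub]].
  - exists B; intros a Ha; destruct (fu_ex F HF _ Ha) as [n Hn].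
    generalize (HB' n); lra.
  - exists (- B); apply (fu_imp F HF (fun n => (0 <= n)%nat));
      [intros; apply HB'|apply fu_tail, HF].
  - exists l; intros e He.
    assert (Hlo : F (fun n => l - e < u n)).
    { destruct (fu_dec F HF (fun n => l - e < u n)) as [H|H]; [exact H|exfalso].
      apply (Rlt_irrefl l), Rle_lt_trans with (l - e); [|lra].
      apply Hlub; intros a Ha; apply Rnot_lt_le; intro Hlt.
      apply (fu_not_both _ Ha); revert H; apply fu_imp; [exact HF|].
      intros n Hn; lra. }
    assert (Hhi : F (fun n => u n < l + e)).
    { destruct (fu_dec F HF (fun n => u n < l + e)) as [H|H]; [exact H|exfalso].
      assert (l + e <= l); [|lra]; apply Hub; revert H; apply fu_imp; [exact HF|].
      intros n Hn; lra. }
    generalize (fu_and F HF _ _ Hlo Hhi); apply fu_imp; [exact HF|].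
    intros n Hn; apply Rabs_lt_between'; lra.
Qed.

Lemma ultra_finite (P : nat -> nat -> Prop) N :
  (forall i, F (P i)) -> F (fun n => forall i, (i < N)%nat -> P i n).
Proof using HF.
  intros HP; induction N as [|N IH].
  - apply (fu_imp F HF (fun n => (0 <= n)%nat)); [intros; lia|apply fu_tail, HF].
  - generalize (fu_and F HF _ _ IH (HP N)); apply fu_imp; [exact HF|].
    intros n [H1 H2] i Hi; destruct (Nat.eq_dec i N) as [->|]; [exact H2|apply H1; lia].
Qed.

End Ultralimit.

Lemma unit_grid (N : nat) t :
  0 <= t <= 1 -> exists i, (i < S (S N))%nat /\ Rabs (t - INR i / INR (S N)) <= / INR (S N).
Proof.
  intros Ht.
  assert (HN : 0 < INR (S N)) by (apply lt_0_INR; lia).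
  destruct (nfloor_ex (t * INR (S N))) as [i Hi]; [nra|].
  exists i; split.
  - apply INR_lt; rewrite (S_INR (S N)); nra.
  - replace (t - INR i / INR (S N)) with ((t * INR (S N) - INR i) * / INR (S N))
      by (field; lra).
    rewrite Rabs_mult, (Rabs_right (/ INR (S N)))
      by (left; now apply Rinv_0_lt_compat).
    rewrite <- (Rmult_1_l (/ INR (S N))) at 2.
    apply Rmult_le_compat_r; [left; now apply Rinv_0_lt_compat|].
    apply Rabs_le_between; lra.
Qed.

(** The cluster point is the pointwise limit along a free ultrafilter; equal
    Lipschitz constants reduce uniform closeness to closeness on a finite
    grid. *)
Lemma ascoli_cluster (L B : R) (p : nat -> R) (x : nat -> R -> R) :
  0 <= L ->
  (forall n, Rabs (p n) <= B) -> (forall n t, Rabs (x n t) <= B) ->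
  (forall n s t, Rabs (x n s - x n t) <= L * Rabs (s - t)) ->
  exists (p' : R) (x' : R -> R),
    (forall s t, Rabs (x' s - x' t) <= L * Rabs (s - t)) /\
    forall e N, 0 < e -> exists n, (N <= n)%nat /\ Rabs (p n - p') <= e /\
      forall t, 0 <= t <= 1 -> Rabs (x n t - x' t) <= e.
Proof.
  intros HL Hp Hx Hlip.
  destruct free_ultrafilter_exists as [F HF].
  destruct (ultralimit F HF B p Hp) as [p' Hp'].
  destruct (functional_choice (fun t l => forall e, 0 < e -> F (fun n => Rabs (x n t - l) < e)))
    as [x' Hx'].
  { intro t; apply (ultralimit F HF B); intro; apply Hx. }
  assert (Hlip' : forall s t, Rabs (x' s - x' t) <= L * Rabs (s - t)).
  { intros s t; apply le_epsilon; intros e He.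
    destruct (fu_ex F HF _ (fu_and F HF _ _ (Hx' s (e / 2) ltac:(lra))
      (Hx' t (e / 2) ltac:(lra)))) as [n [H1 H2]].
    replace (x' s - x' t) with (- (x n s - x' s) + (x n s - x n t) + (x n t - x' t)) by ring.
    eapply Rle_trans; [apply Rabs_triang|].
    eapply Rle_trans; [apply Rplus_le_compat_r, Rabs_triang|].
    rewrite Rabs_Ropp; specialize (Hlip n s t); lra. }
  exists p', x'; split; [exact Hlip'|]; intros e N He.
  (* The mesh [1 / (m + 1)] is so fine that both functions vary by at most [e / 4]
     between a point and the nearest grid point. *)
  destruct (nfloor_ex (4 * L / e)) as [m Hm].
  { apply Rdiv_le_0_compat; lra. }
  assert (HK : 0 < INR (S m)) by (apply lt_0_INR; lia).
  assert (HLK : L * / INR (S m) <= e / 4).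
  { apply Rle_div_l; [assumption|]; rewrite S_INR.
    assert (4 * L < (INR m + 1) * e) by (apply Rlt_div_l; lra); lra. }
  assert (Hgrid := ultra_finite F HF
    (fun i n => Rabs (x n (INR i / INR (S m)) - x' (INR i / INR (S m))) < e / 4)
    (S (S m)) (fun i => Hx' _ (e / 4) ltac:(lra))).
  destruct (fu_ex F HF _ (fu_and F HF _ _ (fu_tail F HF N)
    (fu_and F HF _ _ (Hp' e He) Hgrid))) as [n [Hn [Hpn Hgn]]].
  exists n; split; [exact Hn|]; split; [lra|]; intros t Ht.
  destruct (unit_grid m t Ht) as [i [Hi Hti]].
  specialize (Hgn i Hi); set (g := INR i / INR (S m)) in *.
  assert (H1 := Hlip n t g); assert (H2 := Hlip' g t); rewrite (Rabs_minus_sym g t) in H2.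
  assert (H3 : L * Rabs (t - g) <= L * / INR (S m)) by (apply Rmult_le_compat_l; lra).
  replace (x n t - x' t) with ((x n t - x n g) + (x n g - x' g) + (x' g - x' t)) by ring.
  eapply Rle_trans; [apply Rabs_triang|].
  eapply Rle_trans; [apply Rplus_le_compat_r, Rabs_triang|]; lra.
Qed.

(** * Shooting with a delay *)

(** The right-hand side of the delayed equation, at [s = powr0 q u]. For [h = 0]
    it is that of the original equation. *)
Definition drive (q : R) (g : R -> R -> R) (h : R) (x : R -> R) (u : R) : R :=
  g (powr0 q u) (x (powr0 q u - h)).

Definition solves (q : R) (g : R -> R -> R) (h p : R) (x : R -> R) : Prop :=
  forall t, x t = path q p (drive q g h x) (clip 0 1 t).

(** Picard iterates of the delayed problem. The values on [[0, k h]] are final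
    after [k] iterations. *)
Fixpoint delayed (q : R) (g : R -> R -> R) (h p : R) (k : nat) : R -> R :=
  match k with
  | O => fun t => p * clip 0 1 t
  | S k => fun t => path q p (drive q g h (delayed q g h p k)) (clip 0 1 t)
  end.

Section Shooting.
Context (q M : R) (g : R -> R -> R) (Hq : 1 <= q).
Context (Hgc : forall s z, continuous (fun w : R * R => g (fst w) (snd w)) (s, z)).
Context (Hgb : forall s z, 0 <= g s z <= M).
Context (Hgu : forall e, 0 < e -> exists d, 0 < d /\
  forall s z z', Rabs (z - z') < d -> Rabs (g s z - g s z') < e).

Lemma cont_drive h x : cont x -> cont (drive q g h x).
Proof using Hq Hgc.
  intros Hx u; unfold drive.
  apply (continuous_comp_2 (fun u => powr0 q u) (fun u => x (powr0 q u - h)) g);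
    [apply cont_powr0; lra| |apply Hgc].
  apply (cont_comp x (fun u => powr0 q u - h)); [exact Hx|].
  apply (cont_minus (powr0 q)); [apply cont_powr0; lra|apply cont_const].
Qed.

Lemma clipped_path_lipschitz p y :
  cont y -> (forall u, 0 <= u <= 1 -> 0 <= y u <= M) ->
  forall s t, Rabs (path q p y (clip 0 1 s) - path q p y (clip 0 1 t))
              <= (Rabs p + q * M) * Rabs (s - t).
Proof using Hq Hgb.
  intros Hy Hpos s t; eapply Rle_trans; [exact (path_lipschitz q p M y Hq Hy Hpos _ _)|].
  apply Rmult_le_compat_l; [|apply clip_lipschitz].
  assert (0 <= M) by (generalize (Hgb 0 0); lra).
  generalize (Rabs_pos p); nra.
Qed.

Lemma delayed_lipschitz h p k s t :
  Rabs (delayed q g h p k s - delayed q g h p k t) <= (Rabs p + q * M) * Rabs (s - t).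
Proof using Hq Hgc Hgb.
  revert s t; induction k as [|k IH]; intros s t; simpl.
  - rewrite <- Rmult_minus_distr_l, Rabs_mult.
    assert (0 <= M) by (generalize (Hgb 0 0); lra).
    apply Rmult_le_compat; try apply Rabs_pos; [nra|apply clip_lipschitz].
  - apply clipped_path_lipschitz; [|intros; apply Hgb].
    apply cont_drive, (cont_lipschitz _ _ IH).
Qed.

Lemma cont_delayed h p k : cont (delayed q g h p k).
Proof using Hq Hgc Hgb. exact (cont_lipschitz _ _ (delayed_lipschitz h p k)). Qed.

(** The value of [path] at [t] depends only on the second derivative at
    earlier times. *)
Lemma moment_ext_below y z t :
  (forall u, 0 <= u <= 1 -> powr0 q u < t -> y u = z u) ->
  moment q y (fun s => Rmax 0 (t - s)) = moment q z (fun s => Rmax 0 (t - s)).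
Proof.
  intros Hyz; unfold moment; f_equal; apply RInt_ext; intros u Hu.
  rewrite Rmin_left, Rmax_right in Hu by lra.
  destruct (Rlt_le_dec (powr0 q u) t) as [Hl|Hl].
  - rewrite Hyz by lra; reflexivity.
  - destruct (ramp_cases t (powr0 q u)) as [[? ->]|[? ->]].
    + replace (t - powr0 q u) with 0 by lra; now rewrite !Rmult_0_l.
    + now rewrite !Rmult_0_l.
Qed.

(** The value at [t] involves the previous iterate only up to time [t - h]. *)
Lemma delayed_stable h p k t :
  0 < h -> t <= INR k * h -> delayed q g h p (S k) t = delayed q g h p k t.
Proof using Hq Hgc Hgb.
  intros Hh; revert t; induction k as [|k IH]; intros t Ht.
  - assert (Hc : clip 0 1 t = 0).
    { simpl in Ht; unfold clip, Rmax, Rmin.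
      destruct (Rle_dec 1 t); destruct (Rle_dec 0 _); lra. }
    simpl; rewrite Hc, path_at_0; [ring|exact Hq|].
    apply cont_drive, (cont_delayed h p 0).
  - change (delayed q g h p (S (S k)) t)
      with (path q p (drive q g h (delayed q g h p (S k))) (clip 0 1 t)).
    change (delayed q g h p (S k) t)
      with (path q p (drive q g h (delayed q g h p k)) (clip 0 1 t)).
    unfold path; f_equal; apply moment_ext_below; intros u Hu Hlt.
    unfold drive; rewrite IH; [reflexivity|].
    assert (Hct : clip 0 1 t <= t).
    { assert (H0 := powr0_ge_0 q u); revert Hlt; unfold clip, Rmax, Rmin.
      destruct (Rle_dec 1 t); destruct (Rle_dec 0 _); lra. }
    rewrite S_INR in Ht; lra.
Qed.

Lemma delayed_solves h p k :
  0 < h -> 1 <= INR k * h -> solves q g h p (delayed q g h p k).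
Proof using Hq Hgc Hgb.
  intros Hh Hk t.
  change (delayed q g h p k t = delayed q g h p (S k) t).
  transitivity (delayed q g h p k (clip 0 1 t)).
  - destruct k; simpl; now rewrite (clip_id 0 1 (clip 0 1 t)) by (apply clip_range; lra).
  - rewrite <- delayed_stable;
      [|exact Hh|generalize (clip_range 0 1 t ltac:(lra)); lra].
    simpl; now rewrite (clip_id 0 1 (clip 0 1 t)) by (apply clip_range; lra).
Qed.

Lemma path_close p p' y z e t :
  cont y -> cont z -> 0 <= t <= 1 ->
  (forall u, 0 <= u <= 1 -> Rabs (y u - z u) <= e) ->
  Rabs (path q p y t - path q p' z t) <= Rabs (p - p') + q * e.
Proof using Hq.
  intros Hy Hz Ht Hyz; unfold path.
  assert (HJ : Rabs (moment q y (fun s => Rmax 0 (t - s)) - moment q z (fun s => Rmax 0 (t - s)))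
    <= q * e).
  { apply moment_close; auto using cont_ramp; intros u Hu.
    rewrite <- Rmult_minus_distr_l, Rabs_mult.
    assert (Hs := powr0_ge_0 q u); specialize (Hyz u Hu).
    assert (Hr : Rabs (Rmax 0 (t - powr0 q u)) <= 1).
    { apply Rabs_le_between.
      destruct (ramp_cases t (powr0 q u)) as [[? ->]|[? ->]]; lra. }
    generalize (Rabs_pos (Rmax 0 (t - powr0 q u))) (Rabs_pos (y u - z u)); nra. }
  match goal with |- Rabs (p * t - ?a - (p' * t - ?b)) <= _ =>
    replace (p * t - a - (p' * t - b)) with ((p - p') * t - (a - b)) by ring end.
  eapply Rle_trans; [apply Rabs_triang|]; rewrite Rabs_Ropp, Rabs_mult, (Rabs_right t) by lra.
  generalize (Rabs_pos (p - p')); nra.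
Qed.

(** Each iteration preserves continuity in [p], because [g] is
    uniformly continuous in its second argument. The delay thus replaces any Lipschitz
    condition on [g]. *)
Lemma delayed_continuous_in_slope h p k e :
  0 < e -> exists d, 0 < d /\ forall p', Rabs (p' - p) < d ->
    forall t, Rabs (delayed q g h p' k t - delayed q g h p k t) < e.
Proof using Hq Hgc Hgb Hgu.
  revert e; induction k as [|k IH]; intros e He.
  - exists e; split; [exact He|]; intros p' Hp' t; simpl.
    rewrite <- Rmult_minus_distr_r, Rabs_mult.
    assert (Hc := clip_range 0 1 t ltac:(lra)); rewrite (Rabs_right (clip 0 1 t)) by lra.
    generalize (Rabs_pos (p' - p)); nra.
  - destruct (Hgu (e / (2 * q))) as [d1 [Hd1 Hg]]; [apply Rdiv_lt_0_compat; lra|].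
    destruct (IH d1 Hd1) as [d2 [Hd2 HI]].
    exists (Rmin d2 (e / 2)); split; [apply Rmin_pos; lra|].
    intros p' Hp' t; simpl.
    assert (H2 : Rabs (p' - p) < d2) by (eapply Rlt_le_trans; [exact Hp'|apply Rmin_l]).
    assert (H3 : Rabs (p' - p) < e / 2) by (eapply Rlt_le_trans; [exact Hp'|apply Rmin_r]).
    apply Rle_lt_trans with (Rabs (p' - p) + q * (e / (2 * q))).
    + apply path_close; auto using cont_drive, cont_delayed; [apply clip_range; lra|].
      intros u Hu; left; apply Hg, HI, H2.
    + replace (q * (e / (2 * q))) with (e / 2) by (field; lra); lra.
Qed.

Definition defect (lambda eta : R) (x : R -> R) : R := x 1 - lambda * RInt x 0 eta.

Lemma defect_close lambda eta x y e :
  0 <= lambda -> 0 <= eta <= 1 -> cont x -> cont y ->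
  (forall t, 0 <= t <= 1 -> Rabs (x t - y t) <= e) ->
  Rabs (defect lambda eta x - defect lambda eta y) <= (1 + lambda) * e.
Proof.
  intros Hl He Hx Hy Hxy; unfold defect.
  assert (HI : Rabs (RInt x 0 eta - RInt y 0 eta) <= (eta - 0) * e).
  { apply RInt_close; auto using cont_ex_RInt; [lra|].
    intros u Hu; apply Hxy; lra. }
  assert (H1 := Hxy 1 ltac:(lra)).
  replace (x 1 - lambda * RInt x 0 eta - (y 1 - lambda * RInt y 0 eta))
    with ((x 1 - y 1) - lambda * (RInt x 0 eta - RInt y 0 eta)) by ring.
  eapply Rle_trans; [apply Rabs_triang|].
  rewrite Rabs_Ropp, Rabs_mult, (Rabs_right lambda) by lra.
  assert (He0 := Rabs_pos (x 1 - y 1)); assert ((eta - 0) * e <= e) by nra; nra.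
Qed.

(** For fixed [h] the iteration selects one solution for each slope, and its
    defect is continuous in the slope. *)
Lemma delayed_shooting lambda eta h a b :
  0 <= lambda -> 0 <= eta <= 1 -> 0 < h -> a <= b ->
  (forall x, cont x -> solves q g h a x -> defect lambda eta x <= 0) ->
  (forall x, cont x -> solves q g h b x -> 0 <= defect lambda eta x) ->
  exists p x, a <= p <= b /\ solves q g h p x /\ defect lambda eta x = 0 /\
    forall s t, Rabs (x s - x t) <= (Rabs p + q * M) * Rabs (s - t).
Proof using Hq Hgc Hgb Hgu.
  intros Hl He Hh Hab Ha Hb.
  destruct (nfloor_ex (/ h)) as [k Hk]; [left; now apply Rinv_0_lt_compat|].
  assert (Hk1 : 1 <= INR (S k) * h).
  { rewrite S_INR; replace 1 with (/ h * h) at 1 by (field; lra).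
    apply Rmult_le_compat_r; lra. }
  set (F := fun p => defect lambda eta (delayed q g h p (S k))).
  assert (HF : forall p : R_UniformSpace, continuous F p).
  { intros p P [e HP].
    destruct (delayed_continuous_in_slope h p (S k) (e / (2 * (1 + lambda))))
      as [d [Hd Hdel]]; [apply Rdiv_lt_0_compat; [apply e|lra]|].
    exists (mkposreal d Hd); intros p' Hp'; apply HP.
    change (Rabs (F p' - F p) < e); change (Rabs (p' - p) < d) in Hp'.
    apply Rle_lt_trans with ((1 + lambda) * (e / (2 * (1 + lambda)))).
    - apply defect_close; auto using cont_delayed.
      intros t _; left; apply Hdel, Hp'.
    - replace ((1 + lambda) * (e / (2 * (1 + lambda)))) with (e / 2) by (field; lra).
      generalize (cond_pos e); lra. }
  assert (HFa : F a <= 0) by (apply Ha; [apply cont_delayed|now apply delayed_solves]).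
  assert (HFb : 0 <= F b) by (apply Hb; [apply cont_delayed|now apply delayed_solves]).
  destruct (IVT_gen_consistent F a b 0 HF) as [p [Hp HFp]].
  { rewrite Rmin_left, Rmax_right by lra; lra. }
  rewrite Rmin_left, Rmax_right in Hp by lra.
  exists p, (delayed q g h p (S k)); split; [exact Hp|]; split; [|split; [exact HFp|]].
  - now apply delayed_solves.
  - apply delayed_lipschitz.
Qed.

(** Zeros of the defect for delays [h] tending to 0 cluster at a zero for
    [h = 0]. The two sign conditions concern all solutions of a given
    slope, so that they can be proved by a priori estimates. *)
Lemma shooting lambda eta h0 a b :
  0 <= lambda -> 0 <= eta <= 1 -> 0 < h0 -> 0 <= a <= b ->
  (forall h x, 0 < h <= h0 -> cont x -> solves q g h a x -> defect lambda eta x <= 0) ->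
  (forall h x, 0 < h <= h0 -> cont x -> solves q g h b x -> 0 <= defect lambda eta x) ->
  exists p x, a <= p <= b /\ cont x /\ solves q g 0 p x /\ defect lambda eta x = 0.
Proof using Hq Hgc Hgb Hgu.
  intros Hl He Hh0 Hab Ha Hb.
  set (L := b + q * M).
  assert (HM : 0 <= M) by (generalize (Hgb 0 0); lra).
  assert (HL : 0 <= L) by (unfold L; nra).
  set (h := fun n : nat => h0 / INR (S n)).
  assert (HS : forall n, 1 <= INR (S n)) by (intro n; rewrite S_INR; generalize (pos_INR n); lra).
  assert (Hh : forall n, 0 < h n <= h0).
  { intro n; specialize (HS n); unfold h; split; [apply Rdiv_lt_0_compat; lra|].
    apply Rle_div_l; nra. }
  destruct (functional_choice (fun n (px : R * (R -> R)) =>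
    a <= fst px <= b /\ solves q g (h n) (fst px) (snd px) /\
    defect lambda eta (snd px) = 0 /\
    forall s t, Rabs (snd px s - snd px t) <= L * Rabs (s - t))) as [px Hpx].
  { intro n; destruct (delayed_shooting lambda eta (h n) a b) as [p [x [Hp [Hx [Hd Hlip]]]]];
      try apply Hh; try lra.
    - intros x; apply Ha, Hh.
    - intros x; apply Hb, Hh.
    - exists (p, x); simpl; repeat split; try apply Hp; try assumption.
      intros s t; eapply Rle_trans; [apply Hlip|].
      apply Rmult_le_compat_r; [apply Rabs_pos|].
      unfold L; rewrite Rabs_right by lra; lra. }
  assert (Hcn : forall n, cont (snd (px n))).
  { intro n; destruct (Hpx n) as [_ [_ [_ Hlip]]]; exact (cont_lipschitz _ _ Hlip). }
  assert (Hbd : forall n t, Rabs (snd (px n) t) <= L).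
  { intros n t; destruct (Hpx n) as [_ [Hs [_ Hlip]]].
    assert (Hx0 : snd (px n) 0 = 0).
    { rewrite Hs, clip_id by lra; apply path_at_0; [exact Hq|now apply cont_drive]. }
    assert (Hxc : snd (px n) t = snd (px n) (clip 0 1 t)).
    { rewrite Hs, (Hs (clip 0 1 t)), (clip_id 0 1 (clip 0 1 t));
        [reflexivity|apply clip_range; lra]. }
    rewrite Hxc; specialize (Hlip (clip 0 1 t) 0).
    rewrite Hx0, !Rminus_0_r in Hlip.
    assert (Hc := clip_range 0 1 t ltac:(lra)); rewrite (Rabs_right (clip 0 1 t)) in Hlip by lra.
    nra. }
  destruct (ascoli_cluster L L (fun n => fst (px n)) (fun n => snd (px n)))
    as [p [x0 [Hlip0 Hcl]]]; auto.
  { intro n; destruct (Hpx n) as [Hp _]; rewrite Rabs_right by lra; unfold L; nra. }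
  { intros n s t; apply Hpx. }
  (* A solution is constant outside [[0,1]], but the cluster point is only
     controlled inside. *)
  set (x := fun t => x0 (clip 0 1 t)).
  assert (Hlip : forall s t, Rabs (x s - x t) <= L * Rabs (s - t)).
  { intros s t; eapply Rle_trans; [apply Hlip0|].
    apply Rmult_le_compat_l; [exact HL|apply clip_lipschitz]. }
  assert (Hcx : cont x) by exact (cont_lipschitz _ _ Hlip).
  assert (Hclose : forall e, 0 < e -> exists n,
    Rabs (fst (px n) - p) <= e /\ L * h n <= e /\
    forall t, Rabs (snd (px n) t - x t) <= e).
  { intros e He'; destruct (nfloor_ex (L * h0 / e)) as [N HN].
    { apply Rdiv_le_0_compat; nra. }
    destruct (Hcl e N He') as [n [Hn [H1 H2]]]; exists n; split; [exact H1|]; split.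
    - unfold h; specialize (HS n).
      replace (L * (h0 / INR (S n))) with (L * h0 / INR (S n)) by (field; lra).
      apply Rle_div_l; [lra|].
      assert (INR N <= INR n) by now apply le_INR.
      assert (L * h0 < (INR N + 1) * e) by (apply Rlt_div_l; lra).
      rewrite S_INR; nra.
    - intros t; destruct (Hpx n) as [_ [Hs _]].
      replace (snd (px n) t) with (snd (px n) (clip 0 1 t)).
      + apply H2, clip_range; lra.
      + rewrite Hs, (Hs t), (clip_id 0 1 (clip 0 1 t));
          [reflexivity|apply clip_range; lra]. }
  exists p, x; split; [|split; [exact Hcx|split]].
  - split; apply le_epsilon; intros e He';
      destruct (Hclose e He') as [n [H1 _]]; destruct (Hpx n) as [Hp _];
      apply Rabs_le_between in H1; lra.
  - intros t; apply cond_eq; intros e He'.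
    destruct (Hgu (e / (4 * q))) as [d [Hd Hg]]; [apply Rdiv_lt_0_compat; lra|].
    assert (Hmin : 0 < Rmin (d / 3) (e / 4)) by (apply Rmin_pos; lra).
    destruct (Hclose _ Hmin) as [n [H1 [H2 H3]]].
    assert (Hm1 := Rmin_l (d / 3) (e / 4)); assert (Hm2 := Rmin_r (d / 3) (e / 4)).
    destruct (Hpx n) as [_ [Hs _]].
    assert (Hpc : Rabs (path q (fst (px n)) (drive q g (h n) (snd (px n))) (clip 0 1 t)
      - path q p (drive q g 0 x) (clip 0 1 t))
      <= Rabs (fst (px n) - p) + q * (e / (4 * q))).
    { apply path_close; auto using cont_drive; [apply clip_range; lra|].
      intros u Hu; left; unfold drive; apply Hg.
      set (s := powr0 q u).
      replace (snd (px n) (s - h n) - x (s - 0))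
        with ((snd (px n) (s - h n) - x (s - h n)) + (x (s - h n) - x (s - 0))) by ring.
      eapply Rle_lt_trans; [apply Rabs_triang|].
      specialize (H3 (s - h n)); specialize (Hlip (s - h n) (s - 0)).
      replace (s - h n - (s - 0)) with (- h n) in Hlip by ring.
      rewrite Rabs_Ropp, (Rabs_right (h n)) in Hlip by (generalize (Hh n); lra); lra. }
    rewrite <- Hs in Hpc; replace (q * (e / (4 * q))) with (e / 4) in Hpc by (field; lra).
    specialize (H3 t).
    match goal with |- Rabs (x t - ?b) < _ =>
      replace (x t - b) with (- (snd (px n) t - x t) + (snd (px n) t - b)) by ring end.
    eapply Rle_lt_trans; [apply Rabs_triang|]; rewrite Rabs_Ropp; lra.
  - apply cond_eq; intros e He'; rewrite Rminus_0_r.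
    destruct (Hclose (e / (2 * (1 + lambda)))) as [n [_ [_ H3]]];
      [apply Rdiv_lt_0_compat; lra|].
    destruct (Hpx n) as [_ [_ [Hd _]]].
    assert (Hdc := defect_close lambda eta (snd (px n)) x _ Hl He (Hcn n) Hcx
      (fun t _ => H3 t)).
    rewrite Hd, Rminus_0_l, Rabs_Ropp in Hdc.
    replace ((1 + lambda) * (e / (2 * (1 + lambda)))) with (e / 2) in Hdc by (field; lra); lra.
Qed.

End Shooting.

(** * Truncation of the nonlinearity *)

(** Agrees with [f] wherever a nonnegative solution of slope at most [P] can
    go, and, for continuous [f], is bounded and uniformly continuous on the whole
    plane. *)
Definition truncate (f : R -> R -> R) (P s z : R) : R := f (clip 0 1 s) (clip 0 P z).

Section Truncation.
Context (f : R -> R -> R) (P : R) (HP : 0 <= P).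
Context (Hfcont : continuous_on strip (fun p : R * R => f (fst p) (snd p))).

Lemma truncate_continuous s z :
  continuous (fun w : R * R => truncate f P (fst w) (snd w)) (s, z).
Proof using HP Hfcont.
  set (c := fun w : R * R => (clip 0 1 (fst w), clip 0 P (snd w))).
  assert (Hc : forall w, strip (c w)).
  { intro w; split; simpl; [apply clip_range; lra|].
    apply (clip_range 0 P); exact HP. }
  apply (filterlim_comp _ _ _ c (fun w => f (fst w) (snd w)) _
    (within strip (locally (c (s, z))))); [|exact (Hfcont _ (Hc _))].
  intros Q [e HQ]; exists e; intros w [Hw1 Hw2]; apply HQ; [|apply Hc].
  split; simpl.
  - eapply Rle_lt_trans; [apply clip_lipschitz|exact Hw1].
  - eapply Rle_lt_trans; [apply clip_lipschitz|exact Hw2].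
Qed.

Lemma truncate_uniform e :
  0 < e -> exists d, 0 < d /\ forall s s' z z',
    Rabs (s - s') < d -> Rabs (z - z') < d ->
    Rabs (truncate f P s z - truncate f P s' z') < e.
Proof using HP Hfcont.
  intros He.
  destruct (uniform_continuity_2d (truncate f P) 0 1 0 P) with (eps := mkposreal e He)
    as [d Hd].
  { intros s z _ _; apply continuity_2d_pt_filterlim, truncate_continuous. }
  exists d; split; [apply cond_pos|]; intros s s' z z' Hs Hz.
  assert (Hcc : forall s z,
    truncate f P s z = truncate f P (clip 0 1 s) (clip 0 P z)).
  { intros; unfold truncate; rewrite (clip_id 0 1 (clip 0 1 _)), (clip_id 0 P (clip 0 P _));
      [reflexivity|now apply clip_range|apply clip_range; lra]. }
  rewrite (Hcc s), (Hcc s').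
  apply Hd; try (apply clip_range; lra);
    eapply Rle_lt_trans; try apply clip_lipschitz; assumption.
Qed.

(** One step of length [d / 2] towards the origin changes the value by less than 1,
    and boundedly many steps reach the origin from the whole rectangle. *)
Lemma truncate_bounded : exists M, forall s z, truncate f P s z <= M.
Proof using HP Hfcont.
  destruct (truncate_uniform 1) as [d [Hd Huc]]; [lra|].
  assert (Hind : forall n s z, 0 <= s <= INR n * (d / 2) -> 0 <= z <= INR n * (d / 2) ->
    truncate f P s z <= truncate f P 0 0 + INR n).
  { induction n as [|n IH]; intros s z Hs Hz.
    - simpl in Hs, Hz; replace s with 0 by lra; replace z with 0 by lra; simpl; lra.
    - rewrite S_INR in Hs, Hz.
      assert (Hn := pos_INR n).
      specialize (IH (Rmax 0 (s - d / 2)) (Rmax 0 (z - d / 2))).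
      specialize (Huc s (Rmax 0 (s - d / 2)) z (Rmax 0 (z - d / 2))).
      destruct (ramp_cases s (d / 2)) as [[? E1]|[? E1]], (ramp_cases z (d / 2)) as [[? E2]|[? E2]];
      rewrite E1, E2 in IH, Huc;
      (assert (Hlt : forall t, 0 <= t -> Rabs (t - Rmax 0 (t - d / 2)) < d)
         by (intros t Ht; apply Rabs_lt_between;
             destruct (ramp_cases t (d / 2)) as [[? ->]|[? ->]]; lra);
       assert (H1 := Hlt s ltac:(lra)); assert (H2 := Hlt z ltac:(lra));
       rewrite E1 in H1; rewrite E2 in H2;
       specialize (Huc H1 H2); apply Rabs_lt_between in Huc;
       specialize (IH ltac:(nra) ltac:(nra)); rewrite S_INR; lra). }
  destruct (nfloor_ex ((1 + P) / (d / 2))) as [N HN]; [apply Rdiv_le_0_compat; lra|].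
  exists (truncate f P 0 0 + INR (S N)); intros s z.
  assert (HN1 : 1 + P < INR (S N) * (d / 2)).
  { rewrite S_INR; apply Rlt_div_l; lra. }
  replace (truncate f P s z) with (truncate f P (clip 0 1 s) (clip 0 P z)).
  - assert (H1 := clip_range 0 1 s ltac:(lra)); assert (H2 := clip_range 0 P z HP).
    apply Hind; lra.
  - unfold truncate; rewrite (clip_id 0 1 (clip 0 1 _)), (clip_id 0 P (clip 0 P _));
      [reflexivity|now apply clip_range|apply clip_range; lra].
Qed.

End Truncation.

(** * Sign of the defect for large and small slopes *)

Lemma moment_le_weight q y z phi :
  1 <= q -> cont y -> cont z -> cont phi ->
  (forall s, 0 <= s <= 1 -> 0 <= phi s) ->
  (forall u, 0 <= u <= 1 -> y u <= z u) -> moment q y phi <= moment q z phi.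
Proof.
  intros Hq Hy Hz Hphi Hpos Hle; unfold moment; apply Rmult_le_compat_l; [lra|].
  apply RInt_le; [lra|now apply moment_integrable|now apply moment_integrable|].
  intros u Hu; apply Rmult_le_compat_l; [apply Hpos, powr0_range; lra|apply Hle; lra].
Qed.

Lemma moment_restrict q y phi psi a b :
  1 <= q -> cont y -> cont phi -> cont psi -> 0 <= a <= b -> b <= 1 ->
  (forall u, 0 <= u <= 1 -> 0 <= y u) ->
  (forall s, 0 <= s <= 1 -> 0 <= phi s) ->
  (forall u, a <= u <= b -> psi (powr0 q u) <= phi (powr0 q u) * y u) ->
  q * RInt (fun u => psi (powr0 q u)) a b <= moment q y phi.
Proof.
  intros Hq Hy Hphi Hpsi Hab Hb Hpos Hphi0 Hle; unfold moment; apply Rmult_le_compat_l; [lra|].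
  assert (Hint := fun c d => moment_integrable q y Hq Hy phi c d Hphi).
  rewrite <- (RInt_Chasles (V := R_CompleteNormedModule) _ 0 a 1 (Hint _ _) (Hint _ _)).
  rewrite <- (RInt_Chasles (V := R_CompleteNormedModule) _ a b 1 (Hint _ _) (Hint _ _)).
  unfold plus; simpl.
  assert (Hprod : forall u, 0 <= u <= 1 -> 0 <= phi (powr0 q u) * y u).
  { intros u Hu; apply Rmult_le_pos; [apply Hphi0, powr0_range; lra|now apply Hpos]. }
  assert (H1 : 0 <= RInt (fun u => phi (powr0 q u) * y u) 0 a)
    by (apply RInt_ge_0; [lra|apply Hint|intros; apply Hprod; lra]).
  assert (H2 : 0 <= RInt (fun u => phi (powr0 q u) * y u) b 1)
    by (apply RInt_ge_0; [lra|apply Hint|intros; apply Hprod; lra]).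
  assert (H3 : RInt (fun u => psi (powr0 q u)) a b
    <= RInt (fun u => phi (powr0 q u) * y u) a b).
  { apply RInt_le; [lra| |apply Hint|intros; apply Hle; lra].
    apply cont_ex_RInt, cont_comp; [exact Hpsi|apply cont_powr0; lra]. }
  lra.
Qed.

Section Slopes.
Context (q M : R) (g : R -> R -> R) (Hq : 1 <= q).
Context (Hgc : forall s z, continuous (fun w : R * R => g (fst w) (snd w)) (s, z)).
Context (Hgb : forall s z, 0 <= g s z <= M).
Context (lambda eta : R) (Hlambda : 0 <= lambda) (Heta : 0 <= eta <= 1).
Context (h p : R) (x : R -> R).
Context (Hh : 0 <= h) (Hx : cont x) (Hsol : solves q g h p x).

Let y := drive q g h x.

Let Hy : cont y.
Proof. now apply cont_drive. Qed.

Let Hyb : forall u, 0 <= u <= 1 -> 0 <= y u <= M.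
Proof. intros; apply Hgb. Qed.

Let x_eq t : 0 <= t <= 1 -> x t = path q p y t.
Proof. intros Ht; rewrite (Hsol t), clip_id by exact Ht; reflexivity. Qed.

Let RInt_x : RInt x 0 eta = RInt (path q p y) 0 eta.
Proof.
  apply RInt_ext; intros t Ht; rewrite Rmin_left, Rmax_right in Ht by lra.
  apply x_eq; lra.
Qed.

(** Concavity bounds a solution by its initial tangent; this form with the delay
    is the one that enters [drive]. *)
Lemma solves_le t : 0 <= p -> 0 <= t -> x (t - h) <= p * t.
Proof using Hq Hgc Hgb Hh Hx Hsol.
  intros Hp Ht; rewrite Hsol; eapply Rle_trans; [exact (path_le q p M y Hq Hy Hyb _)|].
  apply Rmult_le_compat_l; [exact Hp|].
  unfold clip, Rmax, Rmin; destruct (Rle_dec 1 (t - h)); destruct (Rle_dec 0 _); lra.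
Qed.

(** Linear growth of [g] and [x(t) <= p t] bound the second derivative
    explicitly, hence [x(1)] from below; the same bound [x(t) <= p t] controls
    the integral term. *)
Lemma defect_large_slope C k :
  0 <= p -> 0 <= C -> 0 <= k ->
  (forall s z, 0 <= s <= 1 -> g s z <= C + k * Rmax 0 z) ->
  p * (1 - lambda * eta ^ 2 / 2 - k * moment q (fun _ => 1) (fun s => s * (1 - s))) - q * C
  <= defect lambda eta x.
Proof using Hq Hgc Hgb Hlambda Heta Hh Hx Hsol.
  intros Hp HC Hk Hg.
  assert (HJ : moment q y (fun s => Rmax 0 (1 - s))
    <= C * moment q (fun _ => 1) (fun s => 1 - s)
       + k * p * moment q (fun _ => 1) (fun s => s * (1 - s))).
  { apply Rle_trans with (moment q (fun u => C + k * p * powr0 q u) (fun s => Rmax 0 (1 - s))).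
    - apply moment_le_weight; auto using cont_ramp.
      + apply (cont_plus (fun _ => C) (fun u => k * p * powr0 q u)); [cont|].
        apply (cont_mult (fun _ => k * p) (powr0 q)); [cont|apply cont_powr0; lra].
      + intros; apply Rmax_l.
      + intros u Hu; unfold y, drive.
        assert (Hs := powr0_range q u ltac:(lra) Hu).
        eapply Rle_trans; [apply Hg, Hs|]; rewrite Rmult_assoc.
        apply Rplus_le_compat_l, Rmult_le_compat_l; [exact Hk|].
        apply Rmax_lub; [nra|]; apply solves_le; lra.
    - rewrite <- !moment_scal, <- moment_plus by first [assumption|cont].
      right; unfold moment; f_equal; apply RInt_ext; intros u Hu.
      rewrite Rmin_left, Rmax_right in Hu by lra.
      assert (Hs := powr0_range q u ltac:(lra) ltac:(lra)).
      rewrite (Rmax_right 0 (1 - powr0 q u)) by lra; simpl; ring. }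
  assert (HJ1 : moment q (fun _ => 1) (fun s => 1 - s) <= q).
  { assert (E : RInt (fun _ : R => 1) 0 1 = 1)
      by (rewrite RInt_const; unfold scal; simpl; unfold mult; simpl; ring).
    apply Rle_trans with (q * RInt (fun _ => 1) 0 1); [|rewrite E; lra].
    unfold moment; apply Rmult_le_compat_l; [lra|].
    apply RInt_le; [lra| |apply ex_RInt_const|].
    - apply (moment_integrable q (fun _ => 1) Hq ltac:(cont) (fun s => 1 - s)); cont.
    - intros u Hu; generalize (powr0_ge_0 q u); lra. }
  assert (HI : RInt x 0 eta <= p * eta ^ 2 / 2).
  { rewrite RInt_x, (RInt_path q p M y Hq Hy Hyb).
    assert (0 <= moment q y (fun s => Rmax 0 (eta - s) * Rmax 0 (eta - s))); [|lra].
    apply moment_ge_0; auto; [cont|intros; apply Hyb; auto|].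
    intros s _; generalize (Rmax_l 0 (eta - s)); nra. }
  unfold defect; rewrite (x_eq 1) by lra; unfold path.
  assert (C * moment q (fun _ => 1) (fun s => 1 - s) <= C * q) by (apply Rmult_le_compat_l; lra).
  assert (lambda * RInt x 0 eta <= lambda * (p * eta ^ 2 / 2))
    by (apply Rmult_le_compat_l; lra).
  lra.
Qed.

(** If the defect is positive, the lower bounds for [x(1)] and for the Green potential
    at [1/2] combine to [x(1/2) >= c x(1/2)] with [c > 1]. The
    factor [theta / 4] is [1/2] from the kernel at [1/2] times [theta / 2] from
    Harnack at the delayed times [s - h >= theta / 2]. *)
Lemma defect_small_slope theta kappa mu :
  0 < theta < 1 / 2 -> h <= theta / 2 -> 0 < p -> lambda * eta ^ 2 < 2 -> 0 <= kappa ->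
  mu = lambda / (2 - lambda * eta ^ 2) ->
  (forall s z, 0 <= s <= 1 -> 0 <= z <= p -> kappa * z <= g s z) ->
  1 < theta / 4 * kappa * (q * RInt (fun u => powr0 q u * (1 - powr0 q u)
         + mu * green_mean eta (powr0 q u)) (Rpower theta (/ q)) (Rpower (1 - theta) (/ q))) ->
  defect lambda eta x <= 0.
Proof using Hq Hgc Hgb Hlambda Heta Hh Hx Hsol.
  intros Hth Hhth Hp Hle Hk Hmu Hg HA.
  apply Rnot_lt_le; intro Hdef; unfold defect in Hdef.
  (* The integral condition as an inequality gives [mu moment (green_mean eta) <= x(1)],
     hence [x(1) >= 0], which is what Harnack needs. *)
  assert (Hy0 : forall u, 0 <= u <= 1 -> 0 <= y u) by (intros; now apply Hyb).
  rewrite (x_eq 1), RInt_x in Hdef by lra.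
  assert (Hmu0 : 0 <= mu) by (subst mu; apply Rdiv_le_0_compat; lra).
  assert (Hend := path_end_lower q p M y Hq Hy Hyb lambda eta Hlambda Hle ltac:(lra)).
  rewrite <- Hmu in Hend.
  assert (Hgm : 0 <= moment q y (green_mean eta)).
  { apply moment_ge_0; auto using cont_green_mean; intros; now apply green_mean_ge_0. }
  assert (Hx1 : 0 <= path q p y 1) by nra.
  set (X := path q p y (1 / 2)).
  assert (HX0 : 0 <= X) by (apply (path_ge_0 q p M y Hq Hy Hyb); [exact Hx1|lra]).
  set (phi := fun s => s * (1 - s) + mu * green_mean eta s) in *.
  assert (Hcphi : cont phi).
  { apply (cont_plus (fun s => s * (1 - s)) (fun s => mu * green_mean eta s)); [cont|].
    apply (cont_mult (fun _ => mu)); [cont|apply cont_green_mean]. }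
  assert (Hphi0 : forall s, 0 <= s <= 1 -> 0 <= phi s).
  { intros s Hs; unfold phi; assert (H1 := green_mean_ge_0 eta s Heta Hs); nra. }
  assert (HXphi : / 2 * moment q y phi <= X).
  { unfold X; rewrite (path_chord q p y Hq Hy (1 / 2)).
    assert (Hgr : moment q y (fun s => / 2 * (s * (1 - s))) <= moment q y (green (1 / 2))).
    { apply moment_le; auto using cont_green; [cont|].
      intros s Hs; generalize (green_half s Hs); lra. }
    rewrite (moment_scal q y Hq Hy (/ 2) (fun s => s * (1 - s))) in Hgr by cont.
    unfold phi; rewrite moment_plus, moment_scal; auto using cont_green_mean; [lra|cont|].
    apply (cont_mult (fun _ => mu)); [cont|apply cont_green_mean]. }
  assert (Hpow : forall t, 0 < t -> t <= 1 -> 0 < Rpower t (/ q) <= 1).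
  { intros t Ht Ht1; split; [apply exp_pos|].
    rewrite <- (Rpower_1_base (/ q)); apply Rle_Rpower_l; [|lra].
    left; apply Rinv_0_lt_compat; lra. }
  assert (Hres : q * RInt (fun u => kappa * (theta / 2) * X * phi (powr0 q u))
    (Rpower theta (/ q)) (Rpower (1 - theta) (/ q)) <= moment q y phi).
  { apply (moment_restrict q y phi (fun s => kappa * (theta / 2) * X * phi s));
      try assumption.
    - apply (cont_mult (fun _ => kappa * (theta / 2) * X)); [cont|exact Hcphi].
    - split; [left; apply Hpow; lra|].
      apply Rle_Rpower_l; [left; apply Rinv_0_lt_compat; lra|lra].
    - apply Hpow; lra.
    - intros u Hu.
      assert (Hs : theta <= powr0 q u <= 1 - theta).
      { split;
          [rewrite <- (powr0_Rpower_inv q theta) by lra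
          |rewrite <- (powr0_Rpower_inv q (1 - theta)) by lra];
          apply powr0_mono; lra. }
      set (s := powr0 q u) in *; rewrite (Rmult_comm (phi s)).
      apply Rmult_le_compat_r; [apply Hphi0; lra|].
      assert (Hxs : theta / 2 * X <= x (s - h)).
      { rewrite x_eq by lra.
        eapply Rle_trans; [|apply (path_harnack q p M y Hq Hy Hyb (s - h) (1 / 2)); lra].
        apply Rmult_le_compat_r; [exact HX0|apply Rmin_glb; lra]. }
      assert (Hxp : x (s - h) <= p * s) by (apply solves_le; lra).
      unfold y, drive; fold s.
      eapply Rle_trans; [|apply Hg; [lra|nra]].
      rewrite Rmult_assoc; now apply Rmult_le_compat_l. }
  assert (Hsc : RInt (fun u => kappa * (theta / 2) * X * phi (powr0 q u))
      (Rpower theta (/ q)) (Rpower (1 - theta) (/ q))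
    = kappa * (theta / 2) * X * RInt (fun u => phi (powr0 q u))
      (Rpower theta (/ q)) (Rpower (1 - theta) (/ q))).
  { rewrite <- (RInt_scal (V := R_CompleteNormedModule)); [reflexivity|].
    apply cont_ex_RInt, cont_comp; [exact Hcphi|apply cont_powr0; lra]. }
  rewrite Hsc in Hres; clear Hsc.
  change (1 < theta / 4 * kappa * (q * RInt (fun u => phi (powr0 q u))
    (Rpower theta (/ q)) (Rpower (1 - theta) (/ q)))) in HA.
  set (A := RInt (fun u => phi (powr0 q u)) (Rpower theta (/ q)) (Rpower (1 - theta) (/ q))) in *.
  assert (HXA : (theta / 4 * kappa * (q * A)) * X <= X) by lra.
  assert (HX : X <= 0) by nra.
  destruct (path_positive_somewhere q p M y Hq Hy Hyb Hp) as [tau [Htau Hpos]].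
  assert (Hh2 := path_harnack q p M y Hq Hy Hyb (1 / 2) tau Hx1 ltac:(lra) ltac:(lra)).
  fold X in Hh2; replace (Rmin (1 / 2) (1 - 1 / 2)) with (1 / 2) in Hh2
    by (rewrite Rmin_left; lra).
  lra.
Qed.

End Slopes.

(** * Integrals of the kernels and conformable derivatives *)

Lemma is_derive_Rpower t b : 0 < t -> is_derive (fun s => Rpower s b) t (b * Rpower t (b - 1)).
Proof. intros Ht; apply is_derive_Reals; now apply derivable_pt_lim_power. Qed.

Lemma continuous_Rpower t b : 0 < t -> continuous (fun s => Rpower s b) t.
Proof.
  intros Ht; apply (ex_derive_continuous (K := R_AbsRing) (V := R_NormedModule)).
  exists (b * Rpower t (b - 1)); now apply is_derive_Rpower.
Qed.

Section Conformable.
Context (alpha : R) (Halpha : 1 < alpha <= 2).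
Let q := / (alpha - 1).

Let Hq : 1 <= q.
Proof. unfold q; rewrite <- Rinv_1 at 1; apply Rinv_le_contravar; lra. Qed.

Let Hqi : / q = alpha - 1.
Proof. unfold q; now rewrite Rinv_inv. Qed.

Let Hqm : q * (alpha - 1) = 1.
Proof. unfold q; field; lra. Qed.

(** The substitution [s = u^q]: since [q (alpha - 1) = 1], the weight [s^(alpha-2)]
    becomes constant. *)
Lemma RInt_powr0 K a b :
  cont K -> 0 < a <= b ->
  q * RInt (fun u => K (powr0 q u)) (Rpower a (/ q)) (Rpower b (/ q))
  = RInt (fun s => K s * Rpower s (alpha - 2)) a b.
Proof using Halpha.
  intros HK Hab; rewrite Hqi.
  assert (HKc : cont (fun u => K (powr0 q u)))
    by (apply cont_comp; [exact HK|apply cont_powr0; lra]).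
  transitivity (RInt (fun u => q * K (powr0 q u))
    (Rpower a (alpha - 1)) (Rpower b (alpha - 1))).
  { symmetry; apply (RInt_scal (V := R_CompleteNormedModule)); now apply cont_ex_RInt. }
  rewrite <- (RInt_comp (V := R_CompleteNormedModule) (fun u => q * K (powr0 q u))
    (fun s => Rpower s (alpha - 1)) (fun s => (alpha - 1) * Rpower s (alpha - 2))).
  - apply RInt_ext; intros s Hs; rewrite Rmin_left, Rmax_right in Hs by lra.
    rewrite <- Hqi at 2; rewrite powr0_Rpower_inv by lra.
    unfold scal; simpl; unfold mult; simpl.
    replace ((alpha - 1) * Rpower s (alpha - 2) * (q * K s))
      with (q * (alpha - 1) * (K s * Rpower s (alpha - 2))) by ring.
    rewrite Hqm; ring.
  - intros s _; apply (cont_mult (fun _ => q) (fun u => K (powr0 q u))); [cont|exact HKc].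
  - intros s Hs; rewrite Rmin_left, Rmax_right in Hs by lra; split.
    + replace (alpha - 2) with (alpha - 1 - 1) by ring; apply is_derive_Rpower; lra.
    + apply (continuous_mult (K := R_AbsRing)); [apply continuous_const|].
      apply continuous_Rpower; lra.
Qed.

Lemma G_diag s : 0 < s -> G alpha s s = s * (1 - s) * Rpower s (alpha - 2).
Proof.
  intros Hs; unfold G; destruct (Rle_dec s s); [|lra].
  replace (alpha - 1) with (1 + (alpha - 2)) by ring.
  rewrite Rpower_plus, Rpower_1 by exact Hs; ring.
Qed.

Lemma H_green_mean eta s : 0 < s -> H alpha eta s = green_mean eta s * Rpower s (alpha - 2).
Proof.
  intros Hs; unfold H, green_mean; destruct (Rle_dec s eta) as [Hle|Hle].
  - rewrite Rmax_right by lra.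
    replace (alpha - 1) with (1 + (alpha - 2)) by ring.
    rewrite Rpower_plus, Rpower_1 by exact Hs; ring.
  - rewrite Rmax_left by lra; ring.
Qed.

Lemma Lambda1_eq eta theta lambda :
  0 < theta < 1 / 2 ->
  Lambda1 alpha eta theta lambda
  = / (theta ^ 4 * (q * RInt (fun u => powr0 q u * (1 - powr0 q u)
      + lambda / (2 - lambda * eta ^ 2) * green_mean eta (powr0 q u))
      (Rpower theta (/ q)) (Rpower (1 - theta) (/ q)))).
Proof using Halpha.
  intros Hth; unfold Lambda1; do 2 f_equal.
  set (mu := lambda / (2 - lambda * eta ^ 2)).
  rewrite (RInt_powr0 (fun s => s * (1 - s) + mu * green_mean eta s)); [| |lra].
  - apply RInt_ext; intros s Hs; rewrite Rmin_left, Rmax_right in Hs by lra.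
    rewrite G_diag, H_green_mean by lra.
    match goal with |- ?a = ?b => change (@eq R a b) end; ring.
  - apply (cont_plus (fun s => s * (1 - s)) (fun s => mu * green_mean eta s)); [cont|].
    apply (cont_mult (fun _ => mu)); [cont|apply cont_green_mean].
Qed.

Lemma green_weight_pos eta theta mu :
  0 < theta < 1 / 2 -> 0 <= eta <= 1 -> 0 <= mu ->
  0 < q * RInt (fun u => powr0 q u * (1 - powr0 q u) + mu * green_mean eta (powr0 q u))
      (Rpower theta (/ q)) (Rpower (1 - theta) (/ q)).
Proof using Halpha.
  intros Hth Heta Hmu.
  assert (Hi : 0 < / q) by (apply Rinv_0_lt_compat; lra).
  apply Rmult_lt_0_compat; [lra|]; apply RInt_gt_0.
  - apply Rlt_Rpower_l; lra.
  - intros u Hu.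
    assert (Hs : theta <= powr0 q u <= 1 - theta).
    { split;
        [rewrite <- (powr0_Rpower_inv q theta) by lra
        |rewrite <- (powr0_Rpower_inv q (1 - theta)) by lra];
        apply powr0_mono; lra. }
    assert (Hg := green_mean_ge_0 eta (powr0 q u) Heta ltac:(lra)).
    assert (0 < powr0 q u * (1 - powr0 q u)) by nra.
    nra.
  - intros u _; revert u.
    apply (cont_comp (fun s => s * (1 - s) + mu * green_mean eta s) (powr0 q));
      [|apply cont_powr0; lra].
    apply (cont_plus (fun s => s * (1 - s)) (fun s => mu * green_mean eta s)); [cont|].
    apply (cont_mult (fun _ => mu)); [cont|apply cont_green_mean].
Qed.

Lemma G_diag_integrable a b : 0 <= a <= b -> ex_RInt (fun s => G alpha s s) a b.
Proof using Halpha.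
  intros Hab.
  (* [Rpower 0 (alpha - 1)] is 1, so the integrand jumps at 0. *)
  apply (ex_RInt_ext (fun s => (1 - s) * powr0 (alpha - 1) s)).
  - intros s Hs; rewrite Rmin_left in Hs by lra.
    rewrite powr0_pos_eq by lra; unfold G; destruct (Rle_dec s s); [reflexivity|lra].
  - apply cont_ex_RInt, (cont_mult (fun s => 1 - s)); [cont|apply cont_powr0; lra].
Qed.

Lemma moment_diag_pos : 0 < moment q (fun _ => 1) (fun s => s * (1 - s)).
Proof using Halpha.
  unfold moment; apply Rmult_lt_0_compat; [lra|]; apply RInt_gt_0; [lra| |].
  - intros u Hu.
    assert (H0 : 0 < powr0 q u) by (rewrite powr0_pos_eq by lra; apply exp_pos).
    assert (H1 : powr0 q u < 1) by (apply powr0_lt_iff; rewrite ?Rpower_1_base; lra).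
    nra.
  - intros u _; revert u.
    apply (cont_mult (fun u => powr0 q u * (1 - powr0 q u))); [|cont].
    apply (cont_comp (fun s => s * (1 - s))); [cont|apply cont_powr0; lra].
Qed.

(** Equality holds; the substitution is only valid away from 0, and the piece
    next to 0 is at most [q] times its length. *)
Lemma moment_diag_le : moment q (fun _ => 1) (fun s => s * (1 - s)) <= RInt (fun s => G alpha s s) 0 1.
Proof using Halpha.
  apply le_epsilon; intros e He.
  (* [[0,v]] in the variable [u] is [[0,a]] in the variable [s]. *)
  set (v := Rmin (1 / 2) (e / q)).
  assert (Hv : 0 < v) by (apply Rmin_pos; [lra|apply Rdiv_lt_0_compat; lra]).
  assert (Hv1 : v <= 1 / 2) by apply Rmin_l.
  assert (Hve : q * v <= e).
  { apply Rle_trans with (q * (e / q)); [apply Rmult_le_compat_l; [lra|apply Rmin_r]|].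
    right; field; lra. }
  set (a := powr0 q v).
  assert (Ha : 0 < a) by (unfold a; rewrite powr0_pos_eq by lra; apply exp_pos).
  assert (Ha1 : a <= 1) by (apply powr0_range; lra).
  assert (Hav : Rpower a (/ q) = v).
  { unfold a; rewrite powr0_pos_eq, Rpower_mult, Rinv_r, Rpower_1; lra. }
  assert (Hc : cont (fun u => powr0 q u * (1 - powr0 q u)))
    by (apply (cont_comp (fun s => s * (1 - s))); [cont|apply cont_powr0; lra]).
  assert (HJ : moment q (fun _ => 1) (fun s => s * (1 - s))
    = q * RInt (fun u => powr0 q u * (1 - powr0 q u)) 0 v
      + RInt (fun s => G alpha s s) a 1).
  { unfold moment.
    rewrite (RInt_ext _ (fun u => powr0 q u * (1 - powr0 q u)))
      by (intros; apply Rmult_1_r).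
    rewrite <- (RInt_Chasles (V := R_CompleteNormedModule) _ 0 v 1
      (cont_ex_RInt _ _ _ Hc) (cont_ex_RInt _ _ _ Hc)).
    unfold plus; simpl; rewrite Rmult_plus_distr_l; f_equal.
    rewrite <- Hav, <- (Rpower_1_base (/ q)) at 1.
    rewrite (RInt_powr0 (fun s => s * (1 - s))) by first [lra|cont].
    apply RInt_ext; intros s Hs; rewrite Rmin_left, Rmax_right in Hs by lra.
    now rewrite G_diag by lra. }
  assert (H1 : RInt (fun u => powr0 q u * (1 - powr0 q u)) 0 v <= v).
  { assert (E : RInt (fun _ : R => 1) 0 v = v)
      by (rewrite RInt_const; unfold scal; simpl; unfold mult; simpl; ring).
    rewrite <- E at 2; apply RInt_le; [lra|now apply cont_ex_RInt|apply ex_RInt_const|].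
    intros u Hu; assert (Hs := powr0_range q u ltac:(lra) ltac:(lra)); nra. }
  assert (H2 : 0 <= RInt (fun s => G alpha s s) 0 a).
  { apply RInt_ge_0; [lra|apply G_diag_integrable; lra|].
    intros s Hs; rewrite G_diag by lra.
    assert (0 < Rpower s (alpha - 2)) by apply exp_pos.
    apply Rmult_le_pos; nra. }
  rewrite <- (RInt_Chasles (V := R_CompleteNormedModule) _ 0 a 1);
    [|apply G_diag_integrable; lra|apply G_diag_integrable; lra].
  unfold plus; simpl.
  assert (q * RInt (fun u => powr0 q u * (1 - powr0 q u)) 0 v <= q * v)
    by (apply Rmult_le_compat_l; lra).
  lra.
Qed.

(** With [mu = lambda / (2 - lambda eta^2)] one has
    [(1 + mu) (2 - lambda eta^2) = 2 - lambda eta^2 + lambda >= 2]. *)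
Lemma Lambda2_bounds eta lambda :
  0 <= eta <= 1 -> 0 <= lambda -> lambda * eta ^ 2 < 2 ->
  0 <= Lambda2 alpha eta lambda /\
  Lambda2 alpha eta lambda / 2 * moment q (fun _ => 1) (fun s => s * (1 - s))
    <= (1 - lambda * eta ^ 2 / 2) / 2.
Proof using Halpha.
  intros He Hl Hle; unfold Lambda2.
  assert (HJ0 := moment_diag_pos); assert (HJ := moment_diag_le).
  set (Jd := moment q (fun _ => 1) (fun s => s * (1 - s))) in *.
  set (I := RInt (fun s => G alpha s s) 0 1) in *.
  set (mu := lambda / (2 - lambda * eta ^ 2)).
  assert (Hmu : 0 <= mu) by (apply Rdiv_le_0_compat; lra).
  assert (Hmu' : mu * (2 - lambda * eta ^ 2) = lambda) by (unfold mu; field; lra).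
  assert (HD : 0 < (1 + mu) * I) by (apply Rmult_lt_0_compat; lra).
  split; [left; now apply Rinv_0_lt_compat|].
  replace (/ ((1 + mu) * I) / 2 * Jd) with (Jd / (2 * ((1 + mu) * I))) by (field; lra).
  apply Rle_div_l; [lra|].
  assert (E : (1 - lambda * eta ^ 2 / 2) / 2 * (2 * ((1 + mu) * I))
    = I * (1 - lambda * eta ^ 2 / 2 + mu * (2 - lambda * eta ^ 2) / 2)) by field.
  rewrite E, Hmu'.
  assert (Heta2 : lambda * eta ^ 2 <= lambda * 1) by (apply Rmult_le_compat_l; nra).
  apply Rle_trans with (I * 1); [lra|apply Rmult_le_compat_l; lra].
Qed.

Lemma is_derive_01_intro x F t l :
  0 < t <= 1 -> (forall s, 0 < s <= 1 -> x s = F s) -> is_derive F t l ->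
  is_derive_01 x t l.
Proof.
  intros Ht HxF HF P [e HP]; apply is_derive_Reals in HF.
  destruct (HF e (cond_pos e)) as [d Hd].
  assert (Hm : 0 < Rmin d t) by (apply Rmin_pos; [apply cond_pos|lra]).
  exists (mkposreal _ Hm); intros s Hs [Hs1 Hst]; apply HP.
  change (Rabs (s - t) < Rmin d t) in Hs.
  assert (Hsd : Rabs (s - t) < d) by (eapply Rlt_le_trans; [exact Hs|apply Rmin_l]).
  assert (Hs0 : Rabs (s - t) < t) by (eapply Rlt_le_trans; [exact Hs|apply Rmin_r]).
  apply Rabs_lt_between in Hs0; unfold unit_interval in Hs1.
  specialize (Hd (s - t) ltac:(lra) Hsd); replace (t + (s - t)) with (s : R) in Hd by (simpl; lra).
  change (Rabs ((x s - x t) / (s - t) - l) < e); now rewrite !HxF by lra.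
Qed.

(** The conformable quotient is [c = t^(2-alpha)] times the ordinary difference
    quotient of [x'] with increment [c eps]. *)
Lemma is_conf_derive_intro x x' t d :
  0 < t <= 1 -> (forall s, 0 < s <= 1 -> is_derive_01 x s (x' s)) ->
  is_derive x' t d -> is_conf_derive alpha x t (Rpower t (2 - alpha) * d).
Proof.
  intros Ht Hx' Hd; exists x'; split; [exact Hx'|].
  set (c := Rpower t (2 - alpha)); assert (Hc : 0 < c) by apply exp_pos.
  intros P [e HP]; apply is_derive_Reals in Hd.
  destruct (Hd (e / c)) as [del Hdel]; [apply Rdiv_lt_0_compat; [apply cond_pos|exact Hc]|].
  assert (Hm : 0 < del / c) by (apply Rdiv_lt_0_compat; [apply cond_pos|exact Hc]).
  exists (mkposreal _ Hm); intros eps Heps [Hne _]; apply HP.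
  change (Rabs (eps - 0) < del / c) in Heps; rewrite Rminus_0_r in Heps.
  apply Rlt_div_r in Heps; [|exact Hc].
  assert (Hh : eps * c <> 0) by (apply Rmult_integral_contrapositive; split; lra).
  specialize (Hdel (eps * c) Hh).
  rewrite Rabs_mult, (Rabs_right c) in Hdel by lra; specialize (Hdel Heps).
  change (Rabs ((x' (t + eps * c) - x' t) / eps - c * d) < e).
  replace ((x' (t + eps * c) - x' t) / eps - c * d)
    with (c * ((x' (t + eps * c) - x' t) / (eps * c) - d)) by (field; lra).
  rewrite Rabs_mult, (Rabs_right c) by lra.
  rewrite Rmult_comm; apply Rlt_div_r in Hdel; [exact Hdel|exact Hc].
Qed.

Section Regularity.
Context (p : R) (y : R -> R) (Hy : cont y).
Let w u := y (powr0 q u).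

Let Hw : cont w.
Proof. apply (cont_comp y (powr0 q)); [exact Hy|apply cont_powr0; lra]. Qed.

Definition path_slope (t : R) : R := p - q * RInt w 0 (Rpower t (alpha - 1)).

Lemma is_derive_RInt_Rpower f t :
  cont f -> 0 < t ->
  is_derive (fun s => RInt f 0 (Rpower s (alpha - 1))) t
    ((alpha - 1) * Rpower t (alpha - 2) * f (Rpower t (alpha - 1))).
Proof using.
  intros Hf Ht.
  apply (is_derive_comp (K := R_AbsRing) (V := R_NormedModule)
    (fun v => RInt f 0 v) (fun s => Rpower s (alpha - 1))).
  - apply (is_derive_RInt f (fun v => RInt f 0 v) 0); [|apply Hf].
    exists (mkposreal 1 Rlt_0_1); intros v _.
    apply (RInt_correct (V := R_CompleteNormedModule)); now apply cont_ex_RInt.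
  - replace (alpha - 2) with (alpha - 1 - 1) by ring; now apply is_derive_Rpower.
Qed.

Lemma is_derive_path_slope t :
  0 < t -> is_derive path_slope t (- (Rpower t (alpha - 2) * y t)).
Proof using Halpha Hy.
  intros Ht.
  assert (HR := is_derive_RInt_Rpower w t Hw Ht).
  unfold w at 2 in HR; rewrite <- Hqi, powr0_Rpower_inv, Hqi in HR by lra.
  apply (is_derive_scal _ t q) in HR.
  assert (HP := is_derive_minus (K := R_AbsRing) (V := R_NormedModule)
    (fun _ => p) _ t _ _ (is_derive_const p t) HR).
  replace (- (Rpower t (alpha - 2) * y t))
    with (minus zero (q * ((alpha - 1) * Rpower t (alpha - 2) * y t))); [exact HP|].
  unfold minus, plus, opp, zero; simpl.
  replace (q * ((alpha - 1) * Rpower t (alpha - 2) * y t))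
    with (q * (alpha - 1) * (Rpower t (alpha - 2) * y t)) by ring.
  rewrite Hqm; ring.
Qed.

(** [path] with the factor [t] taken out of the integral; for [t > 0] this is a
    combination of integrals with smooth upper limit, which the chain rule
    differentiates. *)
Definition path_split (t : R) : R :=
  p * t - q * (t * RInt w 0 (Rpower t (alpha - 1))
               - RInt (fun u => powr0 q u * w u) 0 (Rpower t (alpha - 1))).

Lemma path_eq_split t : 0 < t <= 1 -> path q p w t = path_split t.
Proof using Halpha Hy.
  intros Ht; unfold path, path_split, moment; f_equal; f_equal.
  set (v := Rpower t (alpha - 1)).
  assert (Hv : 0 < v) by apply exp_pos.
  assert (Hv1 : v <= 1).
  { rewrite <- (Rpower_1_base (alpha - 1)); apply Rle_Rpower_l; lra. }
  assert (Hint := fun a b => moment_integrable q w Hq Hw _ a b (cont_ramp t)).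
  rewrite <- (RInt_Chasles (V := R_CompleteNormedModule) _ 0 v 1 (Hint _ _) (Hint _ _)).
  assert (Htv : powr0 q v = t) by (unfold v; rewrite <- Hqi; apply powr0_Rpower_inv; lra).
  assert (E : RInt (fun u => Rmax 0 (t - powr0 q u) * w u) v 1 = 0).
  { rewrite (RInt_ext _ (fun _ => 0)).
    - rewrite RInt_const; unfold scal; simpl; unfold mult; simpl; ring.
    - intros u Hu; rewrite Rmin_left, Rmax_right in Hu by lra.
      assert (t <= powr0 q u) by (rewrite <- Htv; apply powr0_mono; lra).
      rewrite Rmax_left by lra; apply Rmult_0_l. }
  rewrite E; unfold plus; simpl; rewrite Rplus_0_r.
  assert (Hpw : cont (fun u => powr0 q u * w u))
    by (apply (cont_mult (powr0 q)); [apply cont_powr0; lra|exact Hw]).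
  transitivity (RInt (fun u => minus (scal t (w u)) (powr0 q u * w u)) 0 v).
  { apply RInt_ext; intros u Hu; rewrite Rmin_left, Rmax_right in Hu by lra.
    assert (powr0 q u <= t) by (rewrite <- Htv; apply powr0_mono; lra).
    rewrite Rmax_right by lra.
    unfold minus, plus, opp, scal; simpl; unfold mult; simpl; ring. }
  rewrite (RInt_minus (V := R_CompleteNormedModule)), (RInt_scal (V := R_CompleteNormedModule)).
  - reflexivity.
  - now apply cont_ex_RInt.
  - apply cont_ex_RInt, (cont_mult (fun _ => t)); [cont|exact Hw].
  - now apply cont_ex_RInt.
Qed.

(** The two boundary terms cancel because [t - s] vanishes at [s = t]. *)
Lemma is_derive_path_split t : 0 < t -> is_derive path_split t (path_slope t).
Proof using Halpha Hy.
  intros Ht.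
  assert (Hpw : cont (fun u => powr0 q u * w u))
    by (apply (cont_mult (powr0 q)); [apply cont_powr0; lra|exact Hw]).
  assert (HY := is_derive_RInt_Rpower w t Hw Ht).
  assert (HZ := is_derive_RInt_Rpower _ t Hpw Ht); simpl in HZ.
  assert (Et : powr0 q (Rpower t (alpha - 1)) = t)
    by (rewrite <- Hqi; apply powr0_Rpower_inv; lra).
  rewrite Et in HZ.
  unfold path_split, path_slope.
  set (Y := fun s => RInt w 0 (Rpower s (alpha - 1))) in *.
  set (Z := fun s => RInt (fun u => powr0 q u * w u) 0 (Rpower s (alpha - 1))) in *.
  change (is_derive (fun t => p * t - q * (t * Y t - Z t)) t (p - q * Y t)).
  set (a := (alpha - 1) * Rpower t (alpha - 2)) in *.
  set (b := w (Rpower t (alpha - 1))) in *.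
  assert (EY : is_derive Y t (a * b)) by exact HY.
  assert (EZ : is_derive Z t (a * (t * b))) by exact HZ.
  assert (DY := is_derive_unique _ _ _ EY); assert (DZ := is_derive_unique _ _ _ EZ).
  auto_derive.
  - split; [now exists (a * b)|split; [now exists (a * (t * b))|exact I]].
  - change (Derive (fun x => Y x) t) with (Derive Y t).
    change (Derive (fun x => Z x) t) with (Derive Z t).
    rewrite DY, DZ; ring.
Qed.

End Regularity.

Lemma solves_conf_derive (g : R -> R -> R) p x :
  (forall s z, continuous (fun w : R * R => g (fst w) (snd w)) (s, z)) ->
  cont x -> solves q g 0 p x ->
  (forall t, 0 < t <= 1 -> exists l, is_derive_01 x t l) /\
  is_conf_derive_on_01 alpha x (fun t => - g t (x t)).
Proof using Halpha.
  intros Hgc Hx Hsol.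
  set (y := fun t => g t (x t)).
  assert (Hy : cont y).
  { intro t; apply (continuous_comp_2 (fun t => t) x g);
      [apply continuous_id|apply Hx|apply Hgc]. }
  assert (Hxs : forall t, 0 < t <= 1 -> x t = path_split p y t).
  { intros t Ht; rewrite <- path_eq_split by assumption.
    rewrite (Hsol t), clip_id by lra; unfold path, moment; f_equal; f_equal.
    apply RInt_ext; intros u _; unfold drive, y; now rewrite Rminus_0_r. }
  assert (Hd : forall t, 0 < t <= 1 -> is_derive_01 x t (path_slope p y t)).
  { intros t Ht; apply (is_derive_01_intro x (path_split p y)); auto.
    apply is_derive_path_split; [exact Hy|lra]. }
  split; [intros t Ht; exists (path_slope p y t); now apply Hd|split].
  - intros t Ht; replace (- g t (x t))
      with (Rpower t (2 - alpha) * (- (Rpower t (alpha - 2) * y t))).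
    + apply (is_conf_derive_intro x (path_slope p y)); auto.
      apply is_derive_path_slope; [exact Hy|lra].
    + replace (Rpower t (2 - alpha) * - (Rpower t (alpha - 2) * y t))
        with (- (Rpower t (2 - alpha) * Rpower t (alpha - 2)) * y t) by ring.
      rewrite <- Rpower_plus; replace (2 - alpha + (alpha - 2)) with 0 by ring.
      rewrite Rpower_O by lra; unfold y; ring.
  - eapply filterlim_filter_le_1; [apply filter_le_within|].
    apply (continuous_opp (V := R_NormedModule) y 0), Hy.
Qed.

End Conformable.

(** * Growth conditions and the theorem *)

Lemma Rbar_locally_gt l f0 : Rbar_lt (Finite l) f0 -> Rbar_locally f0 (fun z => l < z).
Proof.
  destruct f0 as [r| |]; simpl; intros Hl.
  - assert (Hd : 0 < r - l) by lra.
    exists (mkposreal _ Hd); intros z Hz; apply Rabs_lt_between' in Hz; simpl in Hz; lra.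
  - exists l; auto.
  - contradiction.
Qed.

Lemma Rbar_locally_lt l f0 : Rbar_lt f0 (Finite l) -> Rbar_locally f0 (fun z => z < l).
Proof.
  destruct f0 as [r| |]; simpl; intros Hl.
  - assert (Hd : 0 < l - r) by lra.
    exists (mkposreal _ Hd); intros z Hz; apply Rabs_lt_between' in Hz; simpl in Hz; lra.
  - contradiction.
  - exists l; auto.
Qed.

Lemma f_0_lower f f0 k :
  (forall t, unit_interval t -> 0 <= f t 0) ->
  is_f_0 f f0 -> Rbar_lt (Finite k) f0 ->
  exists d, 0 < d /\ forall t z, unit_interval t -> 0 <= z <= d -> k * z <= f t z.
Proof.
  intros Hf0 [m [Hm Hlim]] Hk.
  destruct (Hlim _ (Rbar_locally_gt _ _ Hk)) as [e He].
  exists (e / 2); split; [generalize (cond_pos e); lra|]; intros t z Ht Hz.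
  destruct (Req_dec z 0) as [->|Hz0]; [rewrite Rmult_0_r; auto|].
  assert (Hkm : k < m z).
  { apply He; [|lra]; change (Rabs (z - 0) < e); rewrite Rminus_0_r, Rabs_right;
      generalize (cond_pos e); lra. }
  destruct (Hm z ltac:(lra)) as [_ Hmin]; specialize (Hmin t Ht); simpl in Hmin.
  apply Rle_div_r; lra.
Qed.

Lemma f_infty_upper f finfty k :
  continuous_on strip (fun p : R * R => f (fst p) (snd p)) ->
  is_f_infty f finfty -> Rbar_lt finfty (Finite k) -> 0 <= k ->
  exists C, 0 <= C /\ forall t z, unit_interval t -> 0 <= z -> f t z <= C + k * z.
Proof.
  intros Hc [m [Hm Hlim]] Hk Hk0.
  destruct (Hlim _ (Rbar_locally_lt _ _ Hk)) as [N HN].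
  set (B := Rmax 1 (N + 1)).
  assert (HB : 1 <= B) by apply Rmax_l; assert (HBN : N + 1 <= B) by apply Rmax_r.
  destruct (truncate_bounded f B ltac:(lra) Hc) as [C HC].
  exists (Rmax 0 C); split; [apply Rmax_l|]; intros t z Ht Hz.
  assert (HC0 := Rmax_l 0 C); assert (HC1 := Rmax_r 0 C).
  destruct (Rle_lt_dec z B) as [HzB|HzB].
  - specialize (HC t z); unfold truncate in HC.
    rewrite !clip_id in HC by (unfold unit_interval in Ht; lra).
    assert (0 <= k * z) by (apply Rmult_le_pos; lra); lra.
  - assert (Hkm : m z < k) by (apply HN; lra).
    destruct (Hm z ltac:(lra)) as [_ Hmax]; specialize (Hmax t Ht); simpl in Hmax.
    assert (f t z <= k * z) by (apply Rle_div_l; lra); lra.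
Qed.

Theorem theorem3p4 (alpha eta theta lambda : R) (f : R -> R -> R)
  (f0 finfty : Rbar)
  (Halpha : 1 < alpha <= 2)
  (Heta : 0 < eta <= 1)
  (Htheta : 0 < theta < 1 / 2)
  (Hlambda : 0 <= lambda < 2 / eta ^ 2)
  (Hfcont : continuous_on strip (fun p : R * R => f (fst p) (snd p)))
  (Hfpos : forall t x, unit_interval t -> 0 <= x -> 0 <= f t x)
  (Hf0 : is_f_0 f f0)
  (Hfinfty : is_f_infty f finfty)
  (HLambda1 : Rbar_lt (Finite (Lambda1 alpha eta theta lambda)) f0)
  (HLambda2 : Rbar_lt finfty (Finite (Lambda2 alpha eta lambda / 2))) :
  exists x : R -> R, is_positive_solution alpha eta lambda f x.
Proof.
  set (q := / (alpha - 1)).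
  assert (Hq : 1 <= q) by (unfold q; rewrite <- Rinv_1 at 1; apply Rinv_le_contravar; lra).
  assert (Hle : lambda * eta ^ 2 < 2) by (apply Rlt_div_r; [apply pow_lt|]; lra).
  assert (Heta' : 0 <= eta <= 1) by lra.
  set (mu := lambda / (2 - lambda * eta ^ 2)).
  assert (Hmu : 0 <= mu) by (apply Rdiv_le_0_compat; lra).
  destruct (Lambda2_bounds alpha Halpha eta lambda Heta' ltac:(lra) Hle) as [HL2 HLJ].
  fold q in HLJ.
  destruct (f_0_lower f f0 _ (fun t Ht => Hfpos t 0 Ht (Rle_refl 0)) Hf0 HLambda1)
    as [a [Ha Hlow]].
  destruct (f_infty_upper f finfty _ Hfcont Hfinfty HLambda2 ltac:(lra))
    as [C [HC Hup]].
  set (k := Lambda2 alpha eta lambda / 2) in *.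
  set (kappa := Lambda1 alpha eta theta lambda) in *.
  set (c := (1 - lambda * eta ^ 2 / 2) / 2).
  assert (Hc : 0 < c) by (unfold c; lra).
  (* A solution of slope [a] stays below height [a], where [f] exceeds [Lambda1 x]; at
     slope [b] the linear term [c b] of the defect absorbs the constant [q C]. *)
  set (b := Rmax a (q * C / c)).
  assert (Hab : a <= b) by apply Rmax_l.
  assert (HbC : q * C <= b * c) by (apply Rle_div_l; [exact Hc|apply Rmax_r]).
  set (g := truncate f b).
  assert (Hgc := truncate_continuous f b ltac:(lra) Hfcont); fold g in Hgc.
  destruct (truncate_bounded f b ltac:(lra) Hfcont) as [M HM]; fold g in HM.
  assert (Hgb : forall s z, 0 <= g s z <= M).
  { intros s z; split; [|apply HM]; apply Hfpos; [apply clip_range; lra|].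
    apply (clip_range 0 b); lra. }
  assert (Hgu : forall e, 0 < e -> exists d, 0 < d /\
    forall s z z', Rabs (z - z') < d -> Rabs (g s z - g s z') < e).
  { intros e He; destruct (truncate_uniform f b ltac:(lra) Hfcont e He) as [d [Hd Hu]].
    exists d; split; [exact Hd|]; intros s z z' Hz; apply Hu; [|exact Hz].
    rewrite Rminus_diag, Rabs_R0; exact Hd. }
  assert (Hgf : forall s z, 0 <= s <= 1 -> 0 <= z <= b -> g s z = f s z).
  { intros s z Hs Hz; unfold g, truncate; now rewrite !clip_id. }
  destruct (shooting q M g Hq Hgc Hgb Hgu lambda eta (theta / 2) a b)
    as [p [x [Hp [Hx [Hsol Hdef]]]]]; try lra.
  - intros h x Hh Hx Hsol.
    assert (HA := green_weight_pos alpha Halpha eta theta mu Htheta Heta' Hmu); fold q in HA.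
    assert (HK := Lambda1_eq alpha Halpha eta theta lambda Htheta).
    fold q in HK; fold mu in HK; fold kappa in HK.
    set (A := q * RInt (fun u => powr0 q u * (1 - powr0 q u) + mu * green_mean eta (powr0 q u))
      (Rpower theta (/ q)) (Rpower (1 - theta) (/ q))) in *.
    assert (Hth4 : 0 < theta ^ 4) by (apply pow_lt; lra).
    assert (HD : 0 < theta ^ 4 * A) by now apply Rmult_lt_0_compat.
    apply (defect_small_slope q M g Hq Hgc Hgb lambda eta ltac:(lra) Heta' h a x
      ltac:(lra) Hx Hsol theta kappa mu); try assumption; try lra.
    + rewrite HK; left; now apply Rinv_0_lt_compat.
    + reflexivity.
    + intros s z Hs Hz; rewrite Hgf by lra; apply Hlow; [exact Hs|lra].
    + fold A; rewrite HK.
      (* The constant is [1 / (4 theta^3)], and [theta < 1/2]. *)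
      replace (theta / 4 * / (theta ^ 4 * A) * A) with (/ (4 * theta ^ 3))
        by (field; lra).
      rewrite <- Rinv_1 at 1; apply Rinv_lt_contravar; [|nra].
      rewrite Rmult_1_r; apply Rmult_lt_0_compat; [lra|apply pow_lt; lra].
  - intros h x Hh Hx Hsol.
    assert (HD := defect_large_slope q M g Hq Hgc Hgb lambda eta ltac:(lra) Heta' h b x
      ltac:(lra) Hx Hsol C k ltac:(lra) HC ltac:(unfold k; lra)).
    assert (Hg : forall s z, 0 <= s <= 1 -> g s z <= C + k * Rmax 0 z).
    { intros s z Hs; unfold g, truncate; rewrite (clip_id 0 1 s) by lra.
      assert (Hz := clip_range 0 b z ltac:(lra)).
      eapply Rle_trans; [apply Hup; [exact Hs|lra]|].
      apply Rplus_le_compat_l, Rmult_le_compat_l; [unfold k; lra|].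
      unfold clip; apply Rle_max_compat_l, Rmin_r. }
    specialize (HD Hg).
    fold c in HLJ.
    assert (b * c <= b * (1 - lambda * eta ^ 2 / 2
      - k * moment q (fun _ => 1) (fun s => s * (1 - s))))
      by (apply Rmult_le_compat_l; unfold c in *; lra).
    lra.
  - exists x.
    assert (Hy : cont (drive q g 0 x)) by (apply cont_drive; assumption).
    assert (Hyb : forall u, 0 <= u <= 1 -> 0 <= drive q g 0 x u <= M)
      by (intros; apply Hgb).
    assert (Hxp : forall t, 0 <= t <= 1 -> x t = path q p (drive q g 0 x) t).
    { intros t Ht; rewrite (Hsol t), clip_id by exact Ht; reflexivity. }
    assert (HI : RInt x 0 eta = RInt (path q p (drive q g 0 x)) 0 eta).
    { apply RInt_ext; intros t Ht; rewrite Rmin_left, Rmax_right in Ht by lra.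
      apply Hxp; lra. }
    unfold defect in Hdef.
    assert (H1 : 0 <= path q p (drive q g 0 x) 1).
    { eapply Rle_trans; [|apply (path_end_lower q p M _ Hq Hy Hyb lambda eta)]; try lra.
      - apply Rmult_le_pos; [exact Hmu|].
        apply moment_ge_0; auto using cont_green_mean;
          [intros u Hu; apply Hyb, Hu|intros; now apply green_mean_ge_0].
      - rewrite <- HI, <- Hxp; lra. }
    assert (Hxpos : forall t, unit_interval t -> 0 <= x t).
    { intros t Ht; rewrite Hxp by exact Ht; now apply (path_ge_0 q p M). }
    assert (Hxb : forall t, unit_interval t -> x t <= b).
    { intros t Ht; rewrite Hxp by exact Ht.
      eapply Rle_trans; [exact (path_le q p M _ Hq Hy Hyb t)|].
      unfold unit_interval in Ht; nra. }
    destruct (solves_conf_derive alpha Halpha g p x Hgc Hx Hsol) as [Hder Hconf].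
    split; [|split; [exact Hxpos|]].
    + split; [|split; [exact Hder|split; [|split]]].
      * intros t _; eapply filterlim_filter_le_1;
          [apply filter_le_within|apply Hx].
      * exists (fun t => - g t (x t)); split; [exact Hconf|]; intros t Ht.
        rewrite Hgf; [ring|exact Ht|split; [apply Hxpos|apply Hxb]; exact Ht].
      * rewrite Hxp by lra; now apply path_at_0.
      * lra.
    + destruct (path_positive_somewhere q p M _ Hq Hy Hyb ltac:(lra)) as [t [Ht Hpos]].
      exists t; split; [unfold unit_interval; lra|]; rewrite Hxp; lra.
Qed.
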